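(* For every non-negative integer $n$ there exist integers $x,y,z,t$ with $$P_8(x)+2P_8(y)+3P_8(z)+7P_8(t)=n,$$ and there exist integers $x',y',z',t'$ with $$P_8(x')+2P_8(y')+3P_8(z')+9P_8(t')=n,$$ where $P_8(x)=3x^2-2x$. That is, the sums $\Phi_{1,2,3,7}$ and $\Phi_{1,2,3,9}$ of generalized octagonal numbers are both universal over $\mathbb{Z}$.
   Context: A generalized octagonal number is an integer of the form $P_8(x)=3x^2-2x$ with $x\in\mathbb{Z}$. For positive integers $a_1,\dots,a_k$, $\Phi_{a_1,\dots,a_k}(x_1,\dots,x_k)=a_1P_8(x_1)+\cdots+a_kP_8(x_k)$; it is called universal over $\mathbb{Z}$ if the equation $\Phi_{a_1,\dots,a_k}(x_1,\dots,x_k)=n$ has an integer solution for every non-negative integer $n$. *)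

(* Defs.v *)
From mathcomp Require Import all_boot all_order all_algebra.

Set Implicit Arguments.
Unset Strict Implicit.
Unset Printing Implicit Defensive.

Import GRing.Theory.
Local Open Scope ring_scope.

Definition P8 (x : int) : int := 3 * x ^+ 2 - 2 * x.

(* The coefficients a_1, ..., a_k are meant to be positive; the definitions
   make sense for arbitrary natural numbers. *)
Definition Phi (k : nat) (a : k.-tuple nat) (x : k.-tuple int) : int :=
  \sum_(i < k) (tnth a i)%:Z * P8 (tnth x i).

Definition universal (k : nat) (a : k.-tuple nat) : Prop :=
  forall n : nat, exists x : k.-tuple int, Phi a x = n%:Z.

(* Main.v *)
From Stdlib Require Import Classical_Prop.
Require Import Defs.
From mathcomp Require Import all_boot all_order all_algebra all_fingroup.
From mathcomp Require Import all_solvable all_field.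
From mathcomp Require Import zify ring lra.

(** Since [3 P8(x) + 1 = (3 x - 1)^2], one has to solve
    [X^2 + 2 Y^2 + 3 Z^2 + c T^2 = 3 n + 6 + c] in integers prime to 3.  For a
    fixed [T] put [3 K = 3 n + 6 + c - c T^2]; with [X = p + 2 s], [Y = p - s]
    the equation becomes [p^2 + Z^2 + 2 s^2 = K], that is, [2 K] is the sum of
    the three squares [p + Z], [p - Z], [2 s].  A suitable [T <= 8] makes [2 K]
    a sum of three squares satisfying the conditions at 3; finitely many [n]
    are left to computation.

    A form of Legendre's three-square theorem is obtained without Dirichlet's
    theorem on primes.  Let [chi] be the quadratic character of discriminant
    [- 4 N] and [r n] the sum of [chi d] over the divisors [d] of [n].  In any
    class [a] modulo [4 N] with [chi a = 1] there is an [n] with [r n <> 0]: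
    otherwise the hyperbola method gives [sum_(d < Y) chi d / d = O(1 / Y)], so
    that [sum_n r n x^n] stays bounded as [x -> 1], although [r >= 0] and
    [r (m^2) >= 1].  The squarefree part [l] of such an [n] has only prime
    factors modulo which [- N] is a square; choosing [a] so that [- n] is a
    square modulo [N] (up to the factor 2), the residues give a positive
    ternary form of determinant 1 representing [N], and such a form is
    equivalent to a sum of three squares. *)

Set Implicit Arguments.
Unset Strict Implicit.
Unset Printing Implicit Defensive.

Import Order.TTheory GRing.Theory Num.Theory.

Local Open Scope ring_scope.

(** * Sums of quadratic characters over divisors *)

(** Summation by parts: once every partial sum of [f] is bounded by [B], the differences
    [w d - w d.+1] and the last weight telescope to [w 1]. *)
Lemma abel_bound (R : realDomainType) (f w : nat -> R) (B : R) (n : nat) :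
  (forall k, `|\sum_(1 <= d < k) f d| <= B) ->
  (forall d, 0 <= w d.+1) -> (forall d, w d.+2 <= w d.+1) ->
  `|\sum_(1 <= d < n) f d * w d| <= B * w 1%N.
Proof.
move=> leB w_ge0 w_le.
have B_ge0 : 0 <= B by apply: le_trans (leB 0%N).
case: n => [|n]; first by rewrite big_geq // normr0 mulr_ge0.
pose P k := \sum_(1 <= d < k.+1) f d.
have PS k : P k.+1 = P k + f k.+1 by rewrite /P big_nat_recr.
have -> : \sum_(1 <= d < n.+1) f d * w d
  = P n * w n.+1 + \sum_(1 <= d < n.+1) P d * (w d - w d.+1).
  elim: n => [|n IHn]; first by rewrite /P !big_geq // mul0r addr0.
  by rewrite big_nat_recr //= IHn [in RHS]big_nat_recr //= PS; ring.
apply: le_trans (ler_normD _ _) _.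
have -> : B * w 1%N = B * w n.+1 + \sum_(1 <= d < n.+1) B * (w d - w d.+1).
  elim: n => [|n IHn]; first by rewrite big_geq // addr0.
  by rewrite IHn [in RHS]big_nat_recr //=; ring.
apply: lerD; first by rewrite normrM (ger0_norm (w_ge0 _)) ler_wpM2r // leB.
apply: le_trans (ler_norm_sum _ _ _) _.
rewrite big_nat_cond [leRHS]big_nat_cond; apply: ler_sum => d /andP[/andP[d1 _] _].
case: d d1 => // d _; rewrite normrM.
have h : 0 <= w d.+1 - w d.+2 by rewrite subr_ge0.
by rewrite (ger0_norm h) ler_wpM2r // leB.
Qed.

(* AM-GM on the pairs [y ^ (2 i)], [y ^ (2 (n - 1 - i))]. *)
Lemma geometric_amgm (R : realFieldType) (y : R) (n : nat) : 0 <= y ->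
  n%:R * y ^+ n <= y * \sum_(i < n) (y ^+ 2) ^+ i.
Proof.
move=> y_ge0.
suff [] : n%:R * y ^+ n <= y * \sum_(i < n) (y ^+ 2) ^+ i /\
  n.+1%:R * y ^+ n.+1 <= y * \sum_(i < n.+1) (y ^+ 2) ^+ i by [].
elim: n => [|n [IH1 IH2]].
  by rewrite big_ord0 mul0r mulr0 big_ord_recl big_ord0 addr0 expr0 mulr1 mul1r expr1.
split => //.
rewrite big_ord_recl big_ord_recr /= expr0.
under eq_bigr do rewrite /bump /= add1n exprS.
rewrite -mulr_sumr /bump /= add1n.
have h : 0 <= (1 - y ^+ n.+1) ^+ 2 by apply: sqr_ge0.
have -> : n.+2%:R * y ^+ n.+2 = y ^+ 2 * (n%:R * y ^+ n) + 2 * (y * y ^+ n.+1).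
  by rewrite -[n.+2]addn2 natrD exprD !exprS; ring.
have -> : (y ^+ 2) ^+ n.+1 = (y ^+ n.+1) ^+ 2 by rewrite -!exprM mulnC.
have := ler_wpM2l (sqr_ge0 y) IH1.
have := mulr_ge0 y_ge0 h.
move: (y ^+ n.+1) (y ^+ n) (\sum_(_ < _) _) => u v s; nra.
Qed.

Lemma geometric_sum (R : comNzRingType) (x : R) n :
  1 - x ^+ n = (1 - x) * \sum_(i < n) x ^+ i.
Proof. by rewrite -opprB subrX1 -mulNr opprB. Qed.

(** What separates a Lambert term from its first-order approximation as [x] tends to 1. For
    [0 < x < 1] it decreases in [d] from the value 1, so its sum against [chi] is bounded uniformly
    in [x]. *)
Definition lambert_gap (R : fieldType) (x : R) (d : nat) : R :=
  (d%:R * (1 - x))^-1 - x ^+ d / (1 - x ^+ d).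

(** * Monotonicity of the Lambert gap *)

Section LambertGap.

Variables (R : realFieldType) (y : R).
Hypothesis y01 : 0 < y < 1.

Let y_gt0 : 0 < y. Proof. by case/andP: y01. Qed.
(** Taking a square provides half-integral powers of [x] without square roots. *)
Let x := y ^+ 2.
Let x_gt0 : 0 < x. Proof. by rewrite exprn_gt0. Qed.
Let x_lt1 : x < 1. Proof. by case/andP: y01 => h1 h2; rewrite exprn_ilt1 // ltW. Qed.
Let A n := \sum_(i < n) x ^+ i.

Let A_gt0 n : 0 < A n.+1.
Proof.
rewrite /A big_ord_recl expr0 ltr_pwDl // sumr_ge0 // => i _.
by rewrite exprn_ge0 // ltW.
Qed.

Let gapE n : lambert_gap x n.+1 = (n.+1%:R^-1 - x ^+ n.+1 / A n.+1) / (1 - x).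
Proof.
rewrite /lambert_gap (geometric_sum x n.+1) -/(A _).
have h1 : 1 - x != 0 by rewrite subr_eq0 eq_sym lt_eqF.
have h2 : A n.+1 != 0 by rewrite gt_eqF.
have h3 : n.+1%:R != 0 :> R by rewrite pnatr_eq0.
move: (A n.+1) (x ^+ n.+1) n.+1%:R (1 - x) h1 h2 h3 => a u k z h1 h2 h3.
by field; rewrite h1 h2 h3.
Qed.

(** With [k = n.+1] this amounts to [k x^k <= A k], which is [geometric_amgm] times [y ^ k], as
    [y <= 1]. *)
Lemma lambert_gap_ge0 n : 0 <= lambert_gap x n.+1.
Proof.
rewrite gapE divr_ge0 ?subr_ge0 //; last exact: ltW.
rewrite ler_pdivrMr // ler_pdivlMl ?ltr0n //.
have := geometric_amgm n.+1 (ltW y_gt0); rewrite -/x -/(A _) => h.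
have yn : 0 < y ^+ n.+1 <= 1 by rewrite exprn_gt0 // exprn_ile1 // ltW //; case/andP: y01.
rewrite /x -exprM mulnC exprM expr2 mulrA.
have := A_gt0 n.
case/andP: y01 yn => _ y1 /andP[yn1 yn2].
move: (y ^+ n.+1) (A n.+1) n.+1%:R yn1 yn2 h => u a k u0 u1 h a0.
have h1 : k * u * u <= y * a * u by rewrite ler_wpM2r // ltW.
have h2 : y * u <= 1 by rewrite mulr_ile1 // ltW.
have h3 : a * (y * u) <= a by rewrite ler_piMr // ltW.
by apply: le_trans h3; rewrite mulrA [a * y]mulrC.
Qed.

(** With [k = n.+1] this amounts to [k (k + 1) x^k <= A k * A (k + 1)]: multiply [geometric_amgm]
    for [k] and [k + 1] and use [y <= 1]. *)
Lemma lambert_gap_le n : lambert_gap x n.+2 <= lambert_gap x n.+1.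
Proof.
rewrite !gapE ler_wpM2r ?invr_ge0 ?subr_ge0 //; first exact: ltW.
have AS : A n.+2 = 1 + x * A n.+1.
  rewrite /A big_ord_recl expr0 mulr_sumr; congr (_ + _).
  by apply: eq_bigr => i _; rewrite exprS.
have h2 : A n.+1 != 0 by rewrite gt_eqF.
have h2' : A n.+2 != 0 by rewrite gt_eqF.
have k1 : n.+1%:R != 0 :> R by rewrite pnatr_eq0.
have k2 : n.+2%:R != 0 :> R by rewrite pnatr_eq0.
rewrite -subr_ge0.
have -> : n.+1%:R^-1 - x ^+ n.+1 / A n.+1 - (n.+2%:R^-1 - x ^+ n.+2 / A n.+2)
  = (A n.+1 * A n.+2 - n.+1%:R * n.+2%:R * x ^+ n.+1)
    / (n.+1%:R * n.+2%:R * (A n.+1 * A n.+2)).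
  have -> : x ^+ n.+2 = x ^+ n.+1 * (A n.+2 - 1) / A n.+1.
    by rewrite AS [1 + _]addrC addrK exprSr mulrA mulfK.
  have e2 : n.+2%:R = n.+1%:R + 1 :> R by rewrite natr1.
  rewrite e2 in k2 *.
  move: (A n.+1) (A n.+2) (x ^+ n.+1) n.+1%:R h2 h2' k1 k2 => a a' u k h2 h2' k1 k2.
  by field; rewrite h2 h2' k1 k2.
rewrite divr_ge0 ?subr_ge0 //; last first.
  by rewrite !mulr_ge0 ?ler0n // ltW.
have := geometric_amgm n.+1 (ltW y_gt0); rewrite -/x -/(A _) => a1.
have := geometric_amgm n.+2 (ltW y_gt0); rewrite -/x -/(A _) => a2.
have yn : 0 < y ^+ n.+1 by rewrite exprn_gt0.
rewrite -(ler_pM2l x_gt0) {1}/x.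
have -> : x ^+ n.+1 = y ^+ n.+1 * y ^+ n.+1 by rewrite /x -exprM mulnC exprM expr2.
have p_ge0 k : 0 <= k%:R * y ^+ k by rewrite mulr_ge0 ?ler0n // exprn_ge0 // ltW.
have h := ler_pM (p_ge0 _) (p_ge0 _) a1 a2.
apply: le_trans (_ : n.+1%:R * y ^+ n.+1 * (n.+2%:R * y ^+ n.+2) <= _).
  rewrite [y ^+ n.+2]exprS.
  have : 0 <= n.+1%:R * n.+2%:R * (y ^+ n.+1 * y ^+ n.+1) * y :> R.
    by rewrite !mulr_ge0 ?ler0n ?(ltW yn) // ltW.
  case/andP: y01 => _ y1; nra.
by apply: le_trans h _; rewrite /x expr2 mulrACA.
Qed.

End LambertGap.

Lemma lambert_gap1 (R : fieldType) (x : R) : 1 - x != 0 -> lambert_gap x 1 = 1.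
Proof. by move=> h; rewrite /lambert_gap mul1r expr1 -{1}[_^-1]mul1r -mulrBl divff. Qed.

Definition divisor_sum (R : nmodType) (chi : nat -> R) (n : nat) : R :=
  \sum_(1 <= d < n.+1 | (d %| n)%N) chi d.

Lemma sum_divisor_sum (R : pzSemiRingType) (chi f : nat -> R) (M : nat) :
  \sum_(1 <= n < M.+1) divisor_sum chi n * f n =
  \sum_(1 <= d < M.+1) chi d * \sum_(1 <= k < (M %/ d).+1) f (d * k)%N.
Proof.
transitivity (\sum_(1 <= n < M.+1) \sum_(1 <= d < M.+1 | (d %| n)%N) chi d * f n).
  rewrite big_nat_cond [RHS]big_nat_cond; apply: eq_bigr => n /andP[/andP[n1 n2] _].
  rewrite mulr_suml (big_nat_widen _ _ _ _ _ n2).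
  rewrite big_nat_cond [RHS]big_nat_cond; apply: eq_bigl => d.
  case: (boolP (d %| n)%N) => //= h; rewrite ?andbF ?andbT //.
  by have := dvdn_leq n1 h; lia.
under eq_bigr do rewrite big_mkcond /=.
rewrite exchange_big /= big_nat_cond [RHS]big_nat_cond.
apply: eq_bigr => d /andP[/andP[d1 d2] _].
rewrite -big_mkcond /= -mulr_sumr; congr (_ * _).
elim: M {d2} => [|M IHM]; first by rewrite div0n !big_geq.
rewrite big_mkcond big_nat_recr //= -big_mkcond IHM divnS //.
case: ifP => h; rewrite ?addr0 ?add0n // add1n [RHS]big_nat_recr //=.
by congr (_ + f _); rewrite mulnC -{1}(divnK h) divnS // h.
Qed.

(** * The hyperbola method for a quadratic character *)

Section QuadraticCharacter.

Variables (R : realFieldType) (D : nat) (chi : nat -> R).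
Hypothesis D_gt0 : (0 < D)%N.
Hypothesis chi_period : forall d, chi (d + D)%N = chi d.
Hypothesis chi_sum0 : \sum_(0 <= d < D) chi d = 0.
Hypothesis chiM : forall d e, chi (d * e)%N = chi d * chi e.
Hypothesis chi_sqr : forall d, chi d * chi d = (coprime D d)%:R.

Lemma chi_norm_le1 d : `|chi d| <= 1.
Proof.
rewrite -(@expr_le1 _ 2) ?normr_ge0 //.
by rewrite real_normK ?num_real // expr2 chi_sqr lern1 leq_b1.
Qed.

Lemma chi0 : chi 0%N = 0.
Proof.
have := chi_sqr 0; rewrite /coprime gcdn0; case: eqP => [D1|_] /eqP.
  by move: chi_sum0; rewrite D1 big_nat1.
by rewrite mulf_eq0 orbb => /eqP.
Qed.

Lemma chi_partial_sum k : `|\sum_(1 <= d < k) chi d| <= D%:R.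
Proof.
have S0 q s : \sum_(0 <= d < q * D + s) chi d = \sum_(0 <= d < s) chi d.
  elim: q => // q IHq; rewrite mulSn -addnA (big_cat_nat (leq0n D) (leq_addr _ _)) /=.
  rewrite chi_sum0 add0r -{1}[D]add0n big_addn addKn -IHq.
  by apply: eq_bigr => d _.
case: k => [|k]; first by rewrite big_geq // normr0.
have -> : \sum_(1 <= d < k.+1) chi d = \sum_(0 <= d < k.+1) chi d.
  by rewrite [RHS]big_ltn // chi0 add0r.
rewrite (divn_eq k.+1 D) S0 (le_trans (ler_norm_sum _ _ _)) //.
apply: le_trans (_ : \sum_(0 <= d < k.+1 %% D) 1 <= _).
  by apply: ler_sum => d _; apply: chi_norm_le1.
by rewrite sumr_const_nat subn0 ler_nat ltnW // ltn_pmod.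
Qed.

Definition counting (d u v : nat) a : nat :=
  (\sum_(u <= k < v) (d * k == a %[mod D]))%N.

(** Multiplication by [d] permutes the residues modulo [D], so each block of [D] consecutive
    integers contributes one and the incomplete block at most one. *)
Lemma counting_bound a d u l : coprime d D ->
  `|D%:R * (counting d u (u + l) a)%:R - l%:R| <= D%:R :> R.
Proof.
move=> cop.
have per v : counting d v (v + D) a = 1%N.
  rewrite /counting -{1}[v]add0n big_addn addKn big_mkord.
  pose f (k : 'I_D) := Ordinal (ltn_pmod (d * (k + v)) D_gt0).
  have inj_f : injective f.
    move=> i j /(congr1 val) /= /eqP; wlog le_ij : i j / (i <= j)%N.
      by move=> W; case: (leqP i j) => [|/ltnW] h; [exact: W | rewrite eq_sym => /(W _ _ h)->].
    rewrite eq_sym eqn_mod_dvd; last by rewrite leq_mul // leq_add2r.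
    rewrite -mulnBr subnDr Gauss_dvdr; last by rewrite coprime_sym.
    move=> h; apply/val_inj => /=; have hj := ltn_ord j.
    case: (posnP (j - i)) => [|p]; first lia.
    have := dvdn_leq p h; lia.
  transitivity (\sum_(i < D) (i == a %% D :> nat))%N.
    by rewrite [RHS](reindex_inj inj_f).
  rewrite (bigD1 (Ordinal (ltn_pmod a D_gt0))) //= eqxx big1 // => i.
  by rewrite -val_eqE /= => /negbTE->.
have bnd s v : (s < D)%N -> (counting d v (v + s) a <= 1)%N.
  move=> hs; rewrite -(per v) /counting.
  by rewrite (big_cat_nat (leq_addr s v) (_ : v + s <= v + D)%N) ?leq_add2l ?leq_addr // ltnW.
have cnt q s v : counting d v (v + (q * D + s)) a = (q + counting d (v + q * D) (v + q * D + s) a)%N.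
  elim: q v => [|q IHq] v; first by rewrite mul0n !addn0.
  rewrite mulSn /counting (@big_cat_nat _ _ _ (v + D)) ?leq_addr //=; last by rewrite -addnA leq_add2l leq_addr.
  rewrite -/(counting d v (v + D) a) per -addnA addnA.
  by rewrite -/(counting _ _ _ _) IHq -!addnA addSn.
have -> : counting d u (u + l) a
    = (l %/ D + counting d (u + l %/ D * D) (u + l %/ D * D + l %% D) a)%N.
  by rewrite -cnt -divn_eq.
have hs : (l %% D < D)%N by rewrite ltn_pmod.
have := bnd _ (u + l %/ D * D)%N hs.
rewrite [X in _ - X%:R](divn_eq l D) !natrD natrM.
move: (counting _ _ _ _) => c hc; move: (l %% D)%N (l %/ D)%N hs => s q hs.
have -> : D%:R * (q%:R + c%:R) - (q%:R * D%:R + s%:R) = D%:R * c%:R - s%:R :> R by ring.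
rewrite -natrM ler_norml; apply/andP; split.
  rewrite lerBrDr addrC lerBlDr -natrD ler_nat; lia.
rewrite lerBlDr -natrD ler_nat; nia.
Qed.

Variable a : nat.
Hypothesis chi_a : chi a = 1.
Hypothesis divisor_sum_a0 : forall n, (0 < n)%N -> n = a %[mod D] -> divisor_sum chi n = 0.

Let chi_mod d : chi (d %% D)%N = chi d.
Proof.
rewrite [in RHS](divn_eq d D); elim: (d %/ D)%N => [|q IHq]; first by rewrite mul0n.
by rewrite mulSn -addnA addnC chi_period.
Qed.

(** The product of the two values is [chi a = 1], and [chi k] squares to 1. *)
Let chi_sym d k : d * k = a %[mod D] -> chi d = chi k.
Proof.
move=> dka; have e : chi d * chi k = 1 by rewrite -chiM -chi_mod dka chi_mod chi_a.
have : chi k * chi k = 1.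
  rewrite chi_sqr; case: (boolP (coprime D k)) => // h.
  have /eqP : chi k * chi k = 0 by rewrite chi_sqr (negbTE h).
  by rewrite mulf_eq0 orbb => /eqP k0; move: e; rewrite k0 mulr0 => /esym/eqP; rewrite oner_eq0.
move=> e2; have k0 : chi k != 0 by apply: contra_eq_neq e2 => ->; rewrite mulr0 eq_sym oner_eq0.
by apply: (mulIf k0); rewrite e e2.
Qed.

(* Dirichlet's hyperbola method: on the class of a the two factors of [n = d k]
   have the same character value, so only the divisors [d < k] matter. *)
Lemma hyperbola (Y : nat) :
  `|\sum_(1 <= d < Y) chi d * (counting d d.+1 (Y ^ 2 %/ d).+1 a)%:R| *+ 2 <= Y%:R.
Proof.
set X := (Y ^ 2)%N.
pose g d k : R := if (d * k <= X)%N && (d * k == a %[mod D]) then chi d else 0.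
have g_sym d k : g d k = g k d.
  rewrite /g mulnC; case: ifP => // /andP[_ /eqP h].
  by apply: chi_sym; rewrite mulnC.
(* Over all pairs, [g] collects [divisor_sum chi n] for [n <= X] in the class of [a], and these
   vanish. *)
have T0 : \sum_(1 <= d < X.+1) \sum_(1 <= k < X.+1) g d k = 0.
  have := sum_divisor_sum chi (fun n => (n == a %[mod D])%:R) X.
  rewrite big_nat_cond big1 => [E|n /andP[/andP[n0 _] _]]; last first.
    by case: eqP => [h|_]; rewrite ?mulr0 // divisor_sum_a0 // mul0r.
  rewrite [RHS]E; apply: eq_big_nat => d /andP[d1 d2].
  rewrite mulr_sumr [RHS](big_nat_widen _ _ X.+1) ?ltnS ?leq_div //.
  rewrite [RHS]big_mkcond; apply: eq_big_nat => k /andP[k1 k2].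
  rewrite /g ltnS leq_divRL // mulnC /=.
  by case: leqP => //= _; case: eqP => _; rewrite ?mulr1 ?mulr0.
have diag : `|\sum_(1 <= d < X.+1) g d d| <= Y%:R.
  apply: le_trans (ler_norm_sum _ _ _) _.
  apply: le_trans (_ : \sum_(1 <= d < X.+1) (d < Y.+1)%N%:R <= _).
    apply: ler_sum => d _; rewrite /g mulnn leq_exp2r // ltnS.
    case: leqP => //= _; last by rewrite normr0.
    by case: eqP => _; rewrite ?normr0 ?ler01 // chi_norm_le1.
  have leYX : (Y.+1 <= X.+1)%N by rewrite ltnS /X; case: (Y) => // y; rewrite expnS leq_pmulr ?expn_gt0.
  rewrite (eq_bigr (fun d => if (d < Y.+1)%N then 1 else 0)); last by move=> d _; case: ifP.
  rewrite -big_mkcond -(big_nat_widen _ _ _ xpredT _ leYX) sumr_const_nat subSS subn0.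
  exact: lexx.
have half : \sum_(1 <= d < X.+1) \sum_(1 <= k < X.+1 | (d < k)%N) g d k
  = \sum_(1 <= d < Y) chi d * (counting d d.+1 (X %/ d).+1 a)%:R.
  have leYX : (Y <= X.+1)%N by rewrite leqW // /X; case: (Y) => // y; rewrite expnS leq_pmulr ?expn_gt0.
  rewrite [RHS](big_nat_widen _ _ _ _ _ leYX) [RHS]big_mkcond.
  apply: eq_big_nat => d /andP[d1 d2] /=; case: ltnP => hd; last first.
    rewrite big_nat_cond big1 // => k /andP[/andP[k1 k2] k3].
    rewrite /g leqNgt (_ : (X < d * k)%N) //.
    apply: leq_ltn_trans (_ : d * d < _)%N; first by rewrite mulnn leq_exp2r.
    by rewrite ltn_pmul2l.
  rewrite natr_sum mulr_sumr [RHS](@big_nat_widenl _ _ _ _ 1) //.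
  rewrite [RHS](big_nat_widen _ _ X.+1) ?ltnS ?leq_div // [LHS]big_mkcond [RHS]big_mkcond.
  apply: eq_big_nat => k /andP[k1 k2] /=; case: (ltnP d k) => //= dk.
  rewrite /g ltnS leq_divRL // mulnC.
  by case: leqP => //= _; case: eqP => _; rewrite ?mulr1 ?mulr0.
have split : \sum_(1 <= d < X.+1) \sum_(1 <= k < X.+1) g d k =
   (\sum_(1 <= d < X.+1) \sum_(1 <= k < X.+1 | (d < k)%N) g d k) *+ 2
   + \sum_(1 <= d < X.+1) g d d.
  have -> : \sum_(1 <= d < X.+1) \sum_(1 <= k < X.+1) g d k =
    \sum_(1 <= d < X.+1) \sum_(1 <= k < X.+1 | (d < k)%N) g d k
    + \sum_(1 <= d < X.+1) \sum_(1 <= k < X.+1 | (k < d)%N) g d k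
    + \sum_(1 <= d < X.+1) g d d.
    rewrite -!big_split /=; apply: eq_big_nat => d hd.
    have -> : g d d = \sum_(1 <= k < X.+1 | k == d) g d k by rewrite big_nat1_eq hd.
    rewrite [in RHS]big_mkcond [X in _ + X + _]big_mkcond [X in _ + _ + X]big_mkcond -!big_split /=.
    by apply: eq_bigr => k _; case: ltngtP; rewrite ?addr0 ?add0r.
  congr (_ + _); rewrite mulr2n; congr (_ + _).
  under eq_bigr do rewrite big_mkcond /=.
  rewrite exchange_big /=; apply: eq_bigr => d _; rewrite -big_mkcond /=.
  by apply: eq_bigr => k _; apply: g_sym.
(* Twice the part [d < k] is minus the diagonal, which has at most [Y] nonzero terms. *)
rewrite -half -normrMn.
move: T0; rewrite split => /eqP; rewrite addr_eq0 => /eqP ->.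
by rewrite normrN.
Qed.

(** Write [d = Y - (Y - d)]: a partial sum of [chi] times [Y], and a sum with decreasing weights for
    [abel_bound]; each is at most [D Y]. *)
Lemma weighted_sum_bound (Y : nat) : `|\sum_(1 <= d < Y) chi d * d%:R| <= (2 * D * Y)%:R.
Proof.
have -> : \sum_(1 <= d < Y) chi d * d%:R =
   (\sum_(1 <= d < Y) chi d) * Y%:R - \sum_(1 <= d < Y) chi d * (Y - d)%:R.
  rewrite mulr_suml -sumrB; apply: eq_big_nat => d /andP[_ d2].
  by rewrite natrB ?(ltnW d2) //; ring.
apply: le_trans (ler_normB _ _) _.
have -> : (2 * D * Y)%:R = D%:R * Y%:R + D%:R * Y%:R :> R by rewrite !natrM; ring.
apply: lerD.
  by rewrite normrM normr_nat ler_wpM2r // chi_partial_sum.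
apply: le_trans (abel_bound (B := D%:R) _ _ _ _) _ => //.
- exact: chi_partial_sum.
- by move=> d; rewrite ler_nat; lia.
- by rewrite ler_wpM2l // ler_nat leq_subr.
Qed.

(** After multiplication by [Y ^ 2], each [Y ^ 2 / d] is replaced by [D * c d + d], with [c d] the
    count in [hyperbola]. The costs are [D Y / 2] from [hyperbola], [(D + 1) Y] from the replacement
    and [2 D Y] from [weighted_sum_bound]. *)
Lemma harmonic_sum_bound (Y : nat) : (0 < Y)%N ->
  `|\sum_(1 <= d < Y) chi d / d%:R| * Y%:R <= (4 * D + 1)%:R.
Proof.
move=> Y_gt0; have Y0 : 0 < Y%:R :> R by rewrite ltr0n.
rewrite -(ler_pM2r Y0) -mulrA.
have YY : Y%:R * Y%:R = `|Y%:R * Y%:R| :> R by rewrite ger0_norm // mulr_ge0.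
rewrite {1}YY -normrM mulr_suml.
set c := fun d => (counting d d.+1 (Y ^ 2 %/ d).+1 a)%:R : R.
(* [D] comes from [counting_bound], and 1 from rounding [Y ^ 2 / d] down. *)
have err d : (1 <= d < Y)%N ->
    `|chi d * (D%:R * c d - (Y%:R * Y%:R / d%:R - d%:R))| <= (D + 1)%:R.
  move=> /andP[d1 d2]; rewrite normrM.
  case: (boolP (coprime D d)) => [cop|ncop]; last first.
    have /eqP : chi d * chi d = 0 by rewrite chi_sqr (negbTE ncop).
    by rewrite mulf_eq0 orbb => /eqP ->; rewrite normr0 mul0r.
  apply: le_trans (ler_wpM2r (normr_ge0 _) (chi_norm_le1 d)) _; rewrite mul1r.
  have le_d : (d <= Y ^ 2 %/ d)%N by rewrite leq_divRL // mulnn leq_exp2r // ltnW.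
  have := @counting_bound a d d.+1 (Y ^ 2 %/ d - d).
  rewrite coprime_sym => /(_ cop); rewrite addSn subnKC // -/(c d) natrB //.
  have hd : 0 < d%:R :> R by rewrite ltr0n.
  have q1 : (Y ^ 2 %/ d)%:R <= Y%:R * Y%:R / d%:R :> R.
    by rewrite ler_pdivlMr // -!natrM ler_nat mulnn leq_trunc_div.
  have q2 : Y%:R * Y%:R / d%:R <= (Y ^ 2 %/ d)%:R + 1 :> R.
    by rewrite ler_pdivrMr // natr1 -!natrM ler_nat mulnn ltnW // ltn_ceil.
  rewrite natrD !ler_norml => /andP[h1 h2]; apply/andP; split; lra.
have E : \sum_(1 <= d < Y) chi d / d%:R * (Y%:R * Y%:R) =
  D%:R * (\sum_(1 <= d < Y) chi d * c d)
  - (\sum_(1 <= d < Y) chi d * (D%:R * c d - (Y%:R * Y%:R / d%:R - d%:R)))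
  + \sum_(1 <= d < Y) chi d * d%:R.
  rewrite mulr_sumr -sumrB -big_split /=; apply: eq_big_nat => d /andP[d1 _].
  by field; rewrite pnatr_eq0; lia.
rewrite E; apply: le_trans (ler_normD _ _) _.
have := weighted_sum_bound Y; have := hyperbola Y; rewrite -/(c _).
have : `|\sum_(1 <= d < Y) chi d * (D%:R * c d - (Y%:R * Y%:R / d%:R - d%:R))| <= (D + 1)%:R * Y%:R.
  apply: le_trans (ler_norm_sum _ _ _) _.
  apply: le_trans (_ : \sum_(1 <= d < Y) (D + 1)%:R <= _).
    rewrite big_nat_cond [leRHS]big_nat_cond; apply: ler_sum => d; rewrite andbT.
    exact: err.
  by rewrite sumr_const_nat -[leLHS]mulr_natr ler_wpM2l // ler_nat leq_subr.
move: (\sum_(1 <= d < Y) chi d * c d) (\sum_(1 <= d < Y) chi d * d%:R) (\sum_(_ <= _ < _) _) => S1 S3 S2.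
rewrite !natrD !natrM => h2 h1 h3.
rewrite -[_ *+ 2]mulr_natr in h1.
have {}h1 : D%:R * `|S1| * 2 <= D%:R * Y%:R by rewrite -mulrA ler_wpM2l.
have := ler_normB (D%:R * S1) S2; rewrite normrM normr_nat.
have : 0 <= D%:R * Y%:R :> R by rewrite mulr_ge0.
lra.
Qed.

End QuadraticCharacter.

(** The omitted tail starts at an exponent above [M], and [1 - x ^ d >= 1 - x]. *)
Lemma geometric_tail (R : realFieldType) (x : R) (d M : nat) : 0 < x < 1 -> (0 < d)%N ->
  `|\sum_(1 <= k < (M %/ d).+1) x ^+ (d * k) - x ^+ d / (1 - x ^+ d)| <= x ^+ M / (1 - x).
Proof.
move=> /andP[x0 x1] d_gt0; have x_ge0 := ltW x0.
have xd : x ^+ d <= x by rewrite -[leRHS]expr1 ler_wiXn2l // ltW.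
have hd : 0 < 1 - x ^+ d by rewrite subr_gt0 (le_lt_trans xd).
have E n : \sum_(1 <= k < n.+1) x ^+ (d * k) = (x ^+ d - x ^+ (d * n.+1)) / (1 - x ^+ d).
  elim: n => [|n IHn]; first by rewrite big_geq // muln1 subrr mul0r.
  rewrite big_nat_recr //= IHn !exprM !(exprS (x ^+ d)).
  by field; rewrite gt_eqF.
rewrite E -mulrBl addrC addKr mulNr normrN ger0_norm; last first.
  by rewrite divr_ge0 ?exprn_ge0 // ltW.
apply: ler_pM; rewrite ?exprn_ge0 ?invr_ge0 ?(ltW hd) //.
  apply: ler_wiXn2l; rewrite ?(ltW x1) //.
  by rewrite ltnW // mulnC ltn_ceil.
have hx : 0 < 1 - x by rewrite subr_gt0.
by rewrite lef_pV2 ?posrE // lerB.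
Qed.

(** * A nonzero divisor sum in every class of character value 1 *)

Section QuadraticCharacter.

Variables (R : realFieldType) (D : nat) (chi : nat -> R).
Hypothesis D_gt0 : (0 < D)%N.
Hypothesis chi_period : forall d, chi (d + D)%N = chi d.
Hypothesis chi_sum0 : \sum_(0 <= d < D) chi d = 0.
Hypothesis chiM : forall d e, chi (d * e)%N = chi d * chi e.
Hypothesis chi_sqr : forall d, chi d * chi d = (coprime D d)%:R.
Hypothesis divisor_sum_ge0 : forall n, (0 < n)%N -> 0 <= divisor_sum chi n.
Hypothesis divisor_sum_sqr : forall m, (0 < m)%N -> 1 <= divisor_sum chi (m ^ 2).

(** Only the terms at squares are kept. *)
Lemma lambert_lower (x : R) (Q M : nat) : 0 <= x -> (Q ^ 2 <= M)%N ->
  \sum_(1 <= m < Q.+1) x ^+ (m ^ 2) <= \sum_(1 <= n < M.+1) divisor_sum chi n * x ^+ n.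
Proof.
move=> x_ge0 leQM.
have -> : \sum_(1 <= m < Q.+1) x ^+ (m ^ 2) =
   \sum_(1 <= n < M.+1) \sum_(1 <= m < Q.+1) if n == (m ^ 2)%N then x ^+ n else 0.
  rewrite exchange_big; apply: eq_big_nat => m /andP[m1 m2] /=.
  rewrite -big_mkcond big_nat1_eq expn_gt0 m1 ltnS (leq_trans _ leQM) //.
  by rewrite leq_exp2r.
rewrite big_nat_cond [leRHS]big_nat_cond; apply: ler_sum => n /andP[/andP[n1 n2] _].
case: (boolP [exists m : 'I_Q.+1, n == (m ^ 2)%N]) => [/existsP[m /eqP nE]|nex].
  have m_gt0 : (0 < m)%N by rewrite lt0n; apply: contraTneq n1 => m0; rewrite nE m0.
  rewrite (eq_bigr (fun i => if i == m :> nat then x ^+ n else 0)); last first.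
    by move=> i _; rewrite nE eqn_exp2r // eq_sym.
  rewrite -big_mkcond big_nat1_eq m_gt0 ltn_ord /= ler_peMl ?exprn_ge0 //.
  by rewrite nE divisor_sum_sqr.
rewrite big_nat_cond big1 ?mulr_ge0 ?divisor_sum_ge0 ?exprn_ge0 //.
move=> m /andP[/andP[m1 m2] _]; case: eqP => // nE; case/negP: nex.
by apply/existsP; exists (Ordinal m2); rewrite nE.
Qed.

(** Each inner sum splits into a truncation error, the main part [1 / (d (1 - x))] and
    [lambert_gap]; these give the three summands in turn, the last by [abel_bound]. *)
Lemma lambert_upper (y : R) (M : nat) : 0 < y < 1 -> (0 < M)%N ->
  \sum_(1 <= n < M.+1) divisor_sum chi n * (y ^+ 2) ^+ n <=
    M%:R * ((y ^+ 2) ^+ M / (1 - y ^+ 2))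
    + `|\sum_(1 <= d < M.+1) chi d / d%:R| / (1 - y ^+ 2) + D%:R.
Proof.
move=> y01 M_gt0; set x := y ^+ 2.
have x01 : 0 < x < 1.
  by case/andP: y01 => h1 h2; rewrite /x exprn_gt0 // exprn_ilt1 // ltW.
have [x0 x1] := andP x01.
rewrite sum_divisor_sum.
pose L := \sum_(1 <= d < M.+1) chi d / d%:R.
pose err d := \sum_(1 <= k < (M %/ d).+1) x ^+ (d * k) - x ^+ d / (1 - x ^+ d).
have -> : \sum_(1 <= d < M.+1) chi d * \sum_(1 <= k < (M %/ d).+1) x ^+ (d * k) =
  \sum_(1 <= d < M.+1) chi d * err d + L / (1 - x) - \sum_(1 <= d < M.+1) chi d * lambert_gap x d.
  rewrite /L mulr_suml -big_split -sumrB /=; apply: eq_big_nat => d /andP[d1 _].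
  rewrite /err /lambert_gap invfM; ring.
apply: le_trans (ler_norm _) _; apply: le_trans (ler_normB _ _) _.
apply: lerD; last first.
  have := @abel_bound _ chi (lambert_gap x) D%:R M.+1.
  rewrite lambert_gap1 ?mulr1 ?gt_eqF ?subr_gt0 //; apply.
  - exact: chi_partial_sum.
  - by move=> d; apply: lambert_gap_ge0.
  - by move=> d; apply: lambert_gap_le.
apply: le_trans (ler_normD _ _) _; apply: lerD; last first.
  by rewrite normrM normfV (gtr0_norm (_ : 0 < 1 - x)) // subr_gt0.
apply: le_trans (ler_norm_sum _ _ _) _.
apply: le_trans (_ : \sum_(1 <= d < M.+1) x ^+ M / (1 - x) <= _); last first.
  by rewrite sumr_const_nat subSS subn0 -[leLHS]mulr_natl.
rewrite big_nat_cond [leRHS]big_nat_cond; apply: ler_sum => d /andP[/andP[d1 _] _].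
rewrite normrM; apply: le_trans (ler_wpM2r (normr_ge0 _) (chi_norm_le1 chi_sqr d)) _.
by rewrite mul1r geometric_tail.
Qed.

(** If all these sums vanished, [harmonic_sum_bound] would keep the Lambert sum at most [D + 2] for
    a suitable [x] near 1, while its terms at squares exceed that. *)
Lemma divisor_sum_residue_class (a : nat) : chi a = 1 ->
  ~ (forall n, (0 < n)%N -> n = a %[mod D] -> divisor_sum chi n = 0).
Proof.
move=> chi_a H.
have LB := harmonic_sum_bound D_gt0 chi_period chi_sum0 chiM chi_sqr chi_a H.
(* [Q / 2] exceeds [D + 2]; [G] makes [y ^ (2 m ^ 2) >= 1 / 2] for [m <= Q]; [C] is the constant of
   [harmonic_sum_bound]; [M] makes the first two terms of [lambert_upper] at most 1 each. *)
pose Q := (2 * D + 5)%N; pose G := (4 * Q ^ 2)%N; pose C := (4 * D + 1)%N.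
pose M := (C * G ^ 3)%N.
have G_gt0 : (1 < G)%N by rewrite /G /Q; nia.
have G0 : 0 < G%:R :> R by rewrite ltr0n ltnW.
pose y : R := 1 - G%:R^-1.
have Gi : 0 < (G%:R^-1 : R) < 1 by rewrite invr_gt0 G0 invf_lt1 // ltr1n.
have y01 : 0 < y < 1 by rewrite /y; lra.
have [y0 y1] := andP y01; have y_ge0 := ltW y0.
have Gn : G%:R != 0 :> R by rewrite gt_eqF.
have E0 : 0 < 1 - y ^+ 2 by rewrite subr_gt0 exprn_ilt1.
have EG : (1 - y ^+ 2)^-1 <= G%:R.
  rewrite -[leRHS]invrK lef_pV2 ?posrE ?invr_gt0 //.
  rewrite expr2 (_ : G%:R^-1 = 1 - y) ?lerB ?ler_piMr // ?(ltW y1) //.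
  by rewrite /y; ring.
have bernoulli n : 1 - n%:R / G%:R <= y ^+ n.
  elim: n => [|n IHn]; first by rewrite mul0r subr0 expr0.
  rewrite exprS; apply: le_trans (ler_wpM2l y_ge0 IHn).
  have : 0 <= n%:R / G%:R / G%:R :> R by rewrite !divr_ge0 // ltW.
  by rewrite -natr1 /y; lra.
have decay n : n%:R * y ^+ n <= G%:R.
  suff h : y ^+ n * (1 + n%:R / G%:R) <= 1.
    have : y ^+ n * (n%:R / G%:R) <= 1.
      by apply: le_trans h; rewrite ler_wpM2l ?exprn_ge0 // lerDr ler01.
    by rewrite mulrA ler_pdivrMr // mul1r mulrC.
  elim: n => [|n IHn]; first by rewrite mul0r addr0 expr0 mulr1.
  apply: le_trans IHn; rewrite exprSr -mulrA ler_wpM2l ?exprn_ge0 //.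
  have : 0 <= n%:R / G%:R / G%:R :> R by rewrite !divr_ge0 // ltW.
  have : 0 <= G%:R^-1 * G%:R^-1 :> R by rewrite mulr_ge0 // ltW // invr_gt0.
  by rewrite -natr1 /y; lra.
have M_gt0 : (0 < M)%N by rewrite /M muln_gt0 expn_gt0 (ltnW G_gt0) /C addn1.
have M0 : 0 < M%:R :> R by rewrite ltr0n.
have leQM : (Q ^ 2 <= M)%N.
  apply: (@leq_trans G); first by rewrite /G leq_pmull.
  by rewrite /M expnS mulnCA leq_pmulr // muln_gt0 expn_gt0 (ltnW G_gt0) /C addn1.
have t1 : M%:R * ((y ^+ 2) ^+ M / (1 - y ^+ 2)) <= 1.
  rewrite -(ler_pM2l M0) mulr1.
  have -> : M%:R * (M%:R * ((y ^+ 2) ^+ M / (1 - y ^+ 2))) =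
    (M%:R * y ^+ M) * (M%:R * y ^+ M) * (1 - y ^+ 2)^-1.
    by rewrite -exprM mulnC exprM expr2; ring.
  apply: le_trans (_ : G%:R * G%:R * G%:R <= _).
    have p : 0 <= M%:R * y ^+ M by rewrite mulr_ge0 ?exprn_ge0.
    by apply: ler_pM => //; [exact: mulr_ge0 | rewrite invr_ge0 ltW | apply: ler_pM].
  by rewrite -!natrM ler_nat /M -mulnA mulnn -expnS leq_pmull // /C addn1.
have t2 : `|\sum_(1 <= d < M.+1) chi d / d%:R| / (1 - y ^+ 2) <= 1.
  have M1 : 0 < M.+1%:R :> R by rewrite ltr0n.
  rewrite -(ler_pM2r M1) mul1r mulrAC.
  apply: le_trans (_ : C%:R * G%:R <= _).
    by apply: ler_pM => //; [rewrite mulr_ge0 | rewrite invr_ge0 ltW | apply: LB].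
  rewrite -natrM ler_nat leqW // /M leq_pmul2l; last by rewrite /C addn1.
  by rewrite expnS leq_pmulr // expn_gt0 (ltnW G_gt0).
have low : Q%:R / 2 <= \sum_(1 <= m < Q.+1) (y ^+ 2) ^+ (m ^ 2).
  apply: le_trans (_ : \sum_(1 <= m < Q.+1) 2^-1 <= _).
    by rewrite sumr_const_nat subSS subn0 -[leRHS]mulr_natl.
  rewrite big_nat_cond [leRHS]big_nat_cond; apply: ler_sum => m /andP[/andP[m1 m2] _].
  rewrite -exprM; apply: le_trans (bernoulli _).
  have : (2 * m ^ 2)%:R / G%:R <= 2^-1 :> R.
    rewrite ler_pdivrMr // mulrC ler_pdivlMr // -natrM ler_nat /G.
    by rewrite mulnAC leq_mul2l leq_exp2r.
  lra.
have := lambert_lower (sqr_ge0 y) leQM.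
have := lambert_upper y01 M_gt0.
have QE : Q%:R = 2 * D%:R + 5 :> R by rewrite /Q natrD natrM.
rewrite QE in low.
move=> up /(le_trans low)/le_trans/(_ up); lra.
Qed.

End QuadraticCharacter.

(** * Divisor sums as products over primes *)

Lemma coprime_part_ind (P : nat -> Prop) : P 1%N ->
  (forall p e k, prime p -> (0 < k)%N -> ~~ (p %| k)%N -> P k -> P (p ^ e * k)%N) ->
  forall n, (0 < n)%N -> P n.
Proof.
move=> P1 Pstep n; have [m] := ubnP n; elim: m => // m IHm in n * => lt_nm n_gt0.
case: (leqP n 1) => [n1|n_gt1]; first by have -> : n = 1%N by lia.
have p_pr := pdiv_prime n_gt1; set p := pdiv n in p_pr.
have [k cop nE] := pfactor_coprime p_pr n_gt0.
have e_gt0 : (0 < logn p n)%N by rewrite logn_gt0 mem_primes p_pr n_gt0 pdiv_dvd.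
have k_gt0 : (0 < k)%N by case: k nE {cop} => // h; move: n_gt0; rewrite h mul0n.
rewrite nE mulnC; apply: Pstep => //; first by rewrite -prime_coprime.
apply: IHm => //; apply: leq_trans (_ : n <= m)%N; last by rewrite -ltnS.
have p_gt1 := prime_gt1 p_pr.
by rewrite [X in (_ < X)%N]nE ltn_Pmulr // -(expn0 p) ltn_exp2l.
Qed.

Section DivisorSum.

Variables (R : realDomainType) (chi : nat -> R).
Hypothesis chi1 : chi 1 = 1.
Hypothesis chiM : forall d e, chi (d * e)%N = chi d * chi e.
Hypothesis chi_cases : forall d, [\/ chi d = 0, chi d = 1 | chi d = -1].

Let chiX d e : chi (d ^ e)%N = chi d ^+ e.
Proof. by elim: e => [|e IHe]; rewrite ?chi1 // expnS chiM IHe exprS. Qed.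

Lemma divisor_sum1 : divisor_sum chi 1 = 1.
Proof. by rewrite /divisor_sum big_mkcond big_nat1 dvd1n chi1. Qed.

(** Induction on [e]: the divisors of [p ^ e.+1 * k] not dividing [p ^ e * k] are the [p ^ e.+1 * j]
    with [j] dividing [k]. *)
Lemma divisor_sum_pfactor p e k : prime p -> (0 < k)%N -> ~~ (p %| k)%N ->
  divisor_sum chi (p ^ e * k) = (\sum_(0 <= i < e.+1) chi p ^+ i) * divisor_sum chi k.
Proof.
move=> p_pr k_gt0 pk; have p_gt0 := prime_gt0 p_pr.
have cop j : coprime (p ^ j) k by rewrite coprimeXl // prime_coprime.
elim: e => [|e IHe]; first by rewrite mul1n big_nat1 mul1r.
rewrite big_nat_recr //= mulrDl -IHe {1}/divisor_sum.
rewrite (bigID (fun d => d %| p ^ e * k)%N) /=; congr (_ + _).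
  rewrite /divisor_sum [RHS](big_nat_widen _ _ (p ^ e.+1 * k).+1) //; last first.
    by rewrite ltnS leq_pmul2r // leq_pexp2l.
  rewrite big_nat_cond [RHS]big_nat_cond; apply: eq_bigl => d.
  case: (boolP (d %| p ^ e * k)%N) => h; rewrite ?andbF //=.
  have hlt : (d < (p ^ e * k).+1)%N.
    by rewrite ltnS; apply: dvdn_leq => //; rewrite muln_gt0 expn_gt0 p_gt0.
  by rewrite hlt (dvdn_trans h) // dvdn_pmul2r // dvdn_exp2l.
rewrite -chiX mulr_sumr; set q := (p ^ e.+1)%N.
have q_gt0 : (0 < q)%N by rewrite expn_gt0 p_gt0.
have im d : (0 < d)%N ->
    (d %| q * k)%N && ~~ (d %| p ^ e * k)%N = (q %| d)%N && (d %/ q %| k)%N.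
  move=> d_gt0; apply/andP/andP => [[d1 d2]|[qd]].
    have [m pm dE] := pfactor_coprime p_pr d_gt0.
    have mk : (m %| k)%N.
      have : (m %| q * k)%N by apply: dvdn_trans d1; rewrite dE dvdn_mulr.
      by rewrite Gauss_dvdr // coprimeXr // coprime_sym.
    have qd : (q %| d)%N.
      rewrite dE; case: (leqP (logn p d) e) => [le_e|lt_e].
        by case/negP: d2; rewrite dE mulnC dvdn_mul // dvdn_exp2l.
      by rewrite dvdn_mull // dvdn_exp2l.
    split => //; rewrite dvdn_divLR //.
    by rewrite mulnC.
  rewrite dvdn_divLR // mulnC => dk; split => //.
  apply: contra pk => d2; have : (q %| p ^ e * k)%N by apply: dvdn_trans d2.
  by rewrite /q expnSr dvdn_pmul2l // expn_gt0 p_gt0.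
have qk_gt0 : (0 < q * k)%N by rewrite muln_gt0 q_gt0.
transitivity (\sum_(1 <= d < (q * k).+1) \sum_(1 <= j < k.+1 | (j %| k)%N)
                 if d == (q * j)%N then chi (q * j) else 0).
  rewrite big_mkcond; apply: eq_big_nat => d /andP[d1 d2]; rewrite im //.
  case: (boolP (q %| d)%N) => [qd|qd] /=; last first.
    by rewrite big1 // => j _; case: eqP => // dE; case/negP: qd; rewrite dE dvdn_mulr.
  have dE j : (d == q * j)%N = (j == d %/ q)%N.
    by apply/eqP/eqP => ->; rewrite ?mulKn // mulnC divnK.
  rewrite big_mkcond (eq_bigr (fun j => if j == (d %/ q)%N then if (j %| k)%N then chi (q * j) else 0 else 0)).
    rewrite -big_mkcond big_nat1_eq /= [(q * (d %/ q))%N]mulnC divnK //.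
    case: (boolP (d %/ q %| k)%N) => dk; last by rewrite if_same.
    by rewrite ltnS (dvdn_leq k_gt0 dk) andbT divn_gt0 // (dvdn_leq d1 qd).
  by move=> j _; rewrite dE; do 2![case: ifP => //].
rewrite (exchange_big_dep_nat (fun j => j %| k)%N) //=.
rewrite big_nat_cond [RHS]big_nat_cond; apply: eq_bigr => j /andP[/andP[j1 j2] jk].
rewrite jk -big_mkcond big_nat1_eq muln_gt0 q_gt0 j1 ltnS leq_pmul2l //.
by rewrite -ltnS j2 chiM.
Qed.

(** A local factor is 1, [e + 1], or an alternating sum equal to 0 or 1. *)
Lemma divisor_sum_ge0 n : (0 < n)%N -> 0 <= divisor_sum chi n.
Proof.
elim/coprime_part_ind: n / => [|p e k p_pr k0 pk IH]; first by rewrite divisor_sum1.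
rewrite divisor_sum_pfactor // mulr_ge0 //.
case: (chi_cases p) => ->.
- by apply: sumr_ge0 => i _; rewrite exprn_ge0.
- by apply: sumr_ge0 => i _; rewrite exprn_ge0.
suff -> : \sum_(0 <= i < e.+1) (-1) ^+ i = (~~ odd e)%:R :> R by rewrite ler0n.
elim: e => [|e IHe]; first by rewrite big_nat1.
by rewrite big_nat_recr //= IHe -signr_odd /=; case: (odd e); rewrite /= ?addr0 ?subrr ?add0r.
Qed.

(** All exponents are even, so after the leading 1 the terms of a local factor pair up as [chi p ^
    (2 i + 1) + chi p ^ (2 i + 2) >= 0]. *)
Lemma divisor_sum_sqr m : (0 < m)%N -> 1 <= divisor_sum chi (m ^ 2).
Proof.
elim/coprime_part_ind: m / => [|p e k p_pr k0 pk IH]; first by rewrite divisor_sum1.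
rewrite expnMn -expnM divisor_sum_pfactor ?expn_gt0 ?k0 //; last first.
  by rewrite Euclid_dvdX // negb_and pk.
rewrite -[leLHS]mulr1; apply: ler_pM => //.
have e2 i : (chi p ^+ 2) ^+ i >= 0 by rewrite exprn_ge0 // sqr_ge0.
rewrite big_nat_recl // expr0 lerDl.
elim: e => [|e IHe]; first by rewrite big_geq.
rewrite mulSn -[(2 + _)%N]addn2 addn2 !big_nat_recr //=.
rewrite -addrA addr_ge0 //.
case: (chi_cases p) => ->.
- by rewrite !exprS !mul0r addr0.
- by rewrite !expr1n addr_ge0.
by rewrite !exprS !mulN1r opprK addNr.
Qed.

(* A prime of odd exponent in n must have character value 1. *)
Lemma divisor_sum_neq0 n : (0 < n)%N ->
  (forall d, (d %| n)%N -> chi d != 0) -> divisor_sum chi n != 0 ->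
  exists m l, [/\ n = (m ^ 2 * l)%N & forall N : nat,
    (forall p, prime p -> chi p = 1 -> exists b : nat, (p %| b ^ 2 + N)%N) ->
    exists b : nat, (l %| b ^ 2 + N)%N].
Proof.
elim/coprime_part_ind: n / => [_ _|p e k p_pr k0 pk IH nz].
  by exists 1%N, 1%N; split => // N _; exists 0%N.
rewrite divisor_sum_pfactor // mulf_eq0 negb_or => /andP[S0 /IH].
have nzk d : (d %| k)%N -> chi d != 0 by move=> dk; apply: nz; rewrite dvdn_mull.
move=> /(_ nzk)[m [l [kE lN]]].
(* An even power of [p] goes into [m]; for odd [e] one factor [p] goes into [l]. *)
case: (boolP (odd e)) => odd_e; last first.
  exists (p ^ e./2 * m)%N, l; split => //.
  by rewrite expnMn -expnM muln2 even_halfK // kE mulnA.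
exists (p ^ e./2 * m)%N, (p * l)%N; split.
  rewrite expnMn -expnM kE mulnACA -expnSr muln2 -mulnA.
  by congr (p ^ _ * _)%N; lia.
move=> N HN; have [b bE] := lN N HN.
have chip : chi p = 1.
  have p0 : chi p != 0 by apply: nz; rewrite dvdn_mulr // -{1}(expn1 p) dvdn_exp2l //; lia.
  case: (chi_cases p) p0 S0 => [->|//|->]; first by rewrite eqxx.
  suff -> : \sum_(0 <= i < e.+1) (-1) ^+ i = 0 :> R by rewrite eqxx.
  have -> : e.+1 = (e.+1./2.*2)%N by lia.
  elim: (e.+1./2) => [|j IHj]; first by rewrite big_geq.
  by rewrite doubleS !big_nat_recr //= IHj add0r exprS mulN1r subrr.
have [c cE] := HN p p_pr chip.
have cop : coprime p l.
  by rewrite prime_coprime //; apply: contra pk => pl; rewrite kE dvdn_mull.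
exists (chinese p l c b).
rewrite Gauss_dvd //; apply/andP; split; rewrite /dvdn -modnDml -modnXm.
  by rewrite chinese_modl // modnXm modnDml.
by rewrite chinese_modr // modnXm modnDml.
Qed.

End DivisorSum.

(** * The Jacobi symbol through Gauss's lemma *)

(** The sign of the least absolute residue of [x] modulo [n]. *)
Definition half_sign (n x : nat) : int := (-1) ^+ (n < 2 * (x %% n))%N.

(* By Gauss's lemma this is the Jacobi symbol (a / n) when n is odd and coprime
   to a; with this definition both multiplicativity in n and periodicity in n
   modulo 4a can be shown without reciprocity. *)
Definition jacobi (a n : nat) : int := \prod_(x < n./2.+1) half_sign n (a * x).

Lemma half_sign_mod n x : half_sign n (x %% n) = half_sign n x.
Proof. by rewrite /half_sign modn_mod. Qed.

Lemma half_sign_sqr n x : half_sign n x * half_sign n x = 1.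
Proof. by rewrite -expr2 sqrr_sign. Qed.

Lemma half_sign_small n x : (x < n./2.+1)%N -> half_sign n x = 1.
Proof.
move=> lt_x; rewrite /half_sign.
case: n lt_x => [|n] lt_x; first by rewrite modn0 (_ : x = 0%N) //; lia.
rewrite modn_small; last lia.
by rewrite (_ : (_ < _)%N = false) //; lia.
Qed.

Lemma half_sign_opp n x y : odd n -> ~~ (n %| x)%N -> (n %| x + y)%N ->
  half_sign n y = - half_sign n x.
Proof.
move=> odd_n nx nxy; rewrite /half_sign.
have n_gt0 : (0 < n)%N by case: (n) odd_n.
have : (x %% n != 0)%N by [].
move: nxy; rewrite /dvdn -modnDm.
have := ltn_pmod x n_gt0; have := ltn_pmod y n_gt0.
move: (x %% n)%N (y %% n)%N => i j ltj lti sE i0.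
have {}sE : (i + j = n)%N.
  case: (ltnP (i + j) n) => h; first by move: sE; rewrite modn_small //; lia.
  move: sE; rewrite -(subnK h) modnDr modn_small; lia.
have -> : (n < 2 * j)%N = ~~ (n < 2 * i)%N by lia.
by case: (n < 2 * i)%N; rewrite /= ?expr0 ?expr1 ?opprK.
Qed.

(* Multiplication by a permutes the residues modulo n up to sign. *)
Lemma prod_half_system (R : comNzRingType) (n a : nat) (c : nat -> R) :
  odd n -> coprime a n -> (forall x, c (x %% n)%N = c x) ->
  (forall x y, (n %| x + y)%N -> c x = c y) ->
  \prod_(x < n./2.+1) c (a * x)%N = \prod_(x < n./2.+1) c x.
Proof.
move=> odd_n cop c_mod c_opp.
have n_gt0 : (0 < n)%N by case: (n) odd_n.
pose rho x := let r := (x %% n)%N in if (n < 2 * r)%N then (n - r)%N else r.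
have rho_lt x : (rho x < n./2.+1)%N by rewrite /rho; have := ltn_pmod x n_gt0; case: ifP; lia.
have c_rho x : c (rho x) = c x.
  rewrite /rho; case: ifP => _; last exact: c_mod.
  apply: c_opp; have lt := ltn_pmod x n_gt0.
  by rewrite /dvdn -modnDmr subnK ?modnn // ltnW.
pose f (x : 'I_n./2.+1) := Ordinal (rho_lt (a * x)%N).
have rho_cong x : (n %| x + rho x)%N \/ (rho x = x %[mod n]).
  rewrite /rho; case: ifP => _; last by right; rewrite modn_mod.
  left; have lt := ltn_pmod x n_gt0.
  by rewrite /dvdn -modnDml subnKC ?modnn // ltnW.
have inj_f : injective f.
  move=> x y /(congr1 val) /= E; apply/val_inj => /=.
  have hx := ltn_ord x; have hy := ltn_ord y.
  have H : (n %| a * (x + y))%N \/ (a * x = a * y %[mod n]).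
    case: (rho_cong (a * x)%N) (rho_cong (a * y)%N) => h1 [] h2; rewrite E in h1.
    - right; apply/eqP; rewrite -(eqn_modDr (rho (a * y)%N)).
      by move: h1 h2; rewrite /dvdn => /eqP-> /eqP->.
    - left; rewrite mulnDr /dvdn -modnDmr -h2 modnDmr; exact: h1.
    - left; rewrite mulnDr /dvdn -modnDml -h1 modnDml addnC; exact: h2.
    - by right; rewrite -h1 -h2.
  case: H => [|/eqP].
    rewrite Gauss_dvdr; last by rewrite coprime_sym.
    case: (posnP (x + y)) => [|h] d; first lia.
    have := dvdn_leq h d; lia.
  wlog le_xy : x y hx hy {E} / (x <= y)%N.
    move=> W; case: (leqP x y) => [|/ltnW] h; first exact: W.
    by rewrite eq_sym => /(W _ _ hy hx h) ->.
  rewrite eq_sym eqn_mod_dvd ?leq_mul // -mulnBr Gauss_dvdr; last by rewrite coprime_sym.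
  case: (posnP (y - x)) => [|h] d; first lia.
  have := dvdn_leq h d; lia.
rewrite [RHS](reindex_inj inj_f) /=.
by apply: eq_bigr => x _; rewrite c_rho.
Qed.

Lemma jacobi_sqr a n : jacobi a n * jacobi a n = 1.
Proof.
rewrite /jacobi -big_split big1 // => x _; exact: half_sign_sqr.
Qed.

Lemma jacobi_mod a b n : a = b %[mod n] -> jacobi a n = jacobi b n.
Proof.
move=> ab; apply: eq_bigr => x _.
by rewrite -half_sign_mod -modnMml ab modnMml half_sign_mod.
Qed.

Lemma jacobi1n n : jacobi 1 n = 1.
Proof. by rewrite /jacobi big1 // => x _; rewrite mul1n half_sign_small. Qed.

Lemma jacobi_n1 a : jacobi a 1 = 1.
Proof. by rewrite /jacobi big_ord_recl big_ord0 muln0. Qed.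

Lemma dvdn_of_add n x y : (n %| x + y)%N -> (n %| x)%N = (n %| y)%N.
Proof.
move=> d; apply/idP/idP => h.
  by rewrite -(dvdn_addr _ h).
by rewrite -(dvdn_addl _ h).
Qed.

(* Any odd sign function computes the symbol. *)
Lemma jacobi_change (e : nat -> int) (a n : nat) : odd n -> coprime a n ->
  (forall x, e x * e x = 1) -> (forall x, e (x %% n)%N = e x) -> e 0%N = 1 ->
  (forall x y, ~~ (n %| x)%N -> (n %| x + y)%N -> e y = - e x) ->
  \prod_(x < n./2.+1) (e (a * x)%N * e x) = jacobi a n.
Proof.
move=> odd_n cop e_sqr e_mod e0 e_opp.
pose c x := e x * half_sign n x.
have cc x : c x * c x = 1 by rewrite /c mulrACA e_sqr half_sign_sqr.
have c_mod x : c (x %% n)%N = c x by rewrite /c e_mod half_sign_mod.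
have c_opp x y : (n %| x + y)%N -> c x = c y.
  move=> d; case: (boolP (n %| x)%N) => hx; last first.
    by rewrite /c (e_opp _ _ hx d) (half_sign_opp odd_n hx d) mulrNN.
  have hy : (n %| y)%N by rewrite -(dvdn_of_add d).
  by rewrite -c_mod -[RHS]c_mod (eqP hx) (eqP hy).
have E := prod_half_system odd_n cop c_mod c_opp.
have -> : \prod_(x < n./2.+1) (e (a * x)%N * e x) =
  (\prod_(x < n./2.+1) c (a * x)%N * jacobi a n) * \prod_(x < n./2.+1) c x.
  rewrite /jacobi -!big_split; apply: eq_bigr => x _ /=.
  rewrite /c -[half_sign n x]mulr1 (half_sign_small (ltn_ord x)) !mulr1.
  by rewrite -!mulrA; congr (_ * _); rewrite mulrA half_sign_sqr mul1r.
rewrite E mulrC mulrA -big_split big1 ?mul1r // => x _; exact: cc.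
Qed.

(** The sign of [b x] relative to that of [x] is even and periodic in [x], so [prod_half_system]
    lets [a x] replace [x]; the signs of [a x] give [jacobi a n]. *)
Lemma jacobiMl a b n : odd n -> coprime a n -> coprime b n ->
  jacobi (a * b) n = jacobi a n * jacobi b n.
Proof.
move=> odd_n copa copb.
pose c x := half_sign n (b * x) * half_sign n x.
have c_mod x : c (x %% n)%N = c x.
  by rewrite /c half_sign_mod -half_sign_mod modnMmr half_sign_mod.
have c_opp x y : (n %| x + y)%N -> c x = c y.
  move=> d; case: (boolP (n %| x)%N) => hx; last first.
    rewrite /c (half_sign_opp odd_n hx d) (@half_sign_opp _ (b * x)%N (b * y)%N) //.
    - by rewrite mulrNN.
    - by rewrite Gauss_dvdr // coprime_sym.
    - by rewrite -mulnDr dvdn_mull.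
  have hy : (n %| y)%N by rewrite -(dvdn_of_add d).
  by rewrite -c_mod -[RHS]c_mod (eqP hx) (eqP hy).
have := prod_half_system odd_n copa c_mod c_opp; rewrite /c !big_split /= => E.
have e1 : \prod_(x < n./2.+1) half_sign n x = 1.
  by rewrite big1 // => x _; rewrite half_sign_small.
move: E; rewrite e1 mulr1 -/(jacobi a n) -/(jacobi b n) => <-.
rewrite mulrC -mulrA jacobi_sqr mulr1.
by apply: eq_bigr => x _; congr half_sign; lia.
Qed.

Lemma prod_periodic (R : comNzRingType) (f : nat -> R) (m q s : nat) :
  (forall x, f (x %% m)%N = f x) ->
  \prod_(0 <= x < q * m + s) f x
  = (\prod_(0 <= x < m) f x) ^+ q * \prod_(0 <= x < s) f x.
Proof.
move=> f_mod; elim: q => [|q IHq]; first by rewrite expr0 mul1r.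
rewrite mulSn -addnA (big_cat_nat (leq0n _) (leq_addr _ _)) //= exprS -mulrA; congr (_ * _).
rewrite -IHq -{1}[m]add0n [(m + _)%N]addnC big_addn addnK.
by apply: eq_bigr => x _; rewrite -f_mod modnDr f_mod.
Qed.

Lemma jacobiMr a n m : odd n -> odd m -> coprime a (n * m) ->
  jacobi a (n * m) = jacobi a n * jacobi a m.
Proof.
move=> odd_n odd_m cop.
have [copn copm] : coprime a n /\ coprime a m.
  by move: cop; rewrite coprimeMr => /andP.
have n_gt0 : (0 < n)%N by case: (n) odd_n.
have m_gt0 : (0 < m)%N by case: (m) odd_m.
have le_m : (m./2.+1 <= m)%N by lia.
(* A sign function modulo [n * m] adapted to the factorization, to be fed to [jacobi_change]. *)
pose e x := if (m %| x)%N then half_sign n (x %/ m) else half_sign m x.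
have e_sqr x : e x * e x = 1 by rewrite /e; case: ifP => _; apply: half_sign_sqr.
have e_mod x : e (x %% (n * m))%N = e x.
  rewrite /e.
  have -> : (m %| x %% (n * m))%N = (m %| x)%N by rewrite /dvdn modn_dvdm // dvdn_mull.
  case: ifP => [mx|_].
    by rewrite -half_sign_mod -[in RHS]half_sign_mod -{1}(divnK mx) -muln_modl mulnK ?modn_mod.
  by rewrite -half_sign_mod modn_dvdm ?dvdn_mull // half_sign_mod.
have e0 : e 0%N = 1 by rewrite /e dvdn0 div0n half_sign_small.
have e_opp x y : ~~ (n * m %| x)%N -> (n * m %| x + y)%N -> e y = - e x.
  move=> hx hxy; have mxy : (m %| x + y)%N by apply: dvdn_trans hxy; rewrite dvdn_mull.
  rewrite /e -(dvdn_of_add mxy).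
  case: ifP => [mx|/negbT mx]; last exact: half_sign_opp.
  have my : (m %| y)%N by rewrite -(dvdn_of_add mxy).
  apply: half_sign_opp => //.
    by rewrite dvdn_divRL.
  by rewrite -divnDl // dvdn_divRL.
have odd_nm : odd (n * m) by rewrite oddM odd_n.
rewrite -(jacobi_change odd_nm cop e_sqr e_mod e0 e_opp).
(* The multiples of m contribute (a / n); the other residues only depend on x
   modulo m, so each full period cancels and (a / m) remains. *)
pose g x := half_sign m (a * x) * half_sign m x.
have gm x : g (x %% m)%N = g x.
  by rewrite /g half_sign_mod -half_sign_mod modnMmr half_sign_mod.
pose g' x := if (m %| x)%N then 1 else g x.
have gg' x : g x = g' x.
  rewrite /g'; case: ifP => // mx; rewrite -gm (eqP mx) /g muln0.
  by rewrite half_sign_sqr.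
pose k x := if (m %| x)%N then half_sign n (a * (x %/ m)) * half_sign n (x %/ m) else 1.
have Ee x : e (a * x)%N * e x = g x * k x.
  rewrite gg' /g' /k /e Gauss_dvdr; last by rewrite coprime_sym.
  by case: ifP => mx; rewrite ?mul1r ?mulr1 // muln_divA.
rewrite (eq_bigr _ (fun (x : 'I__) _ => Ee x)) big_split /= mulrC.
have jE (b p : nat) : \prod_(x < p./2.+1) (half_sign p (b * x) * half_sign p x) = jacobi b p.
  rewrite big_split /= [X in _ * X]big1 ?mulr1 // => x _.
  by rewrite half_sign_small.
congr (_ * _).
  rewrite -jE.
  pose F x : int := half_sign n (a * x) * half_sign n x.
  have := big_mkord xpredT k => <-.
  rewrite -[RHS](big_mkord xpredT F) [LHS](eq_bigr (fun x => if (m %| x)%N then F (x %/ m)%N else 1)) //.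
  have -> : ((n * m)./2.+1 = n./2 * m + m./2.+1)%N by lia.
  elim: (n./2) => [|q IHq].
    rewrite mul0n add0n big_nat1 big_nat_recl // dvdn0 div0n.
    rewrite big_nat_cond big1 ?mulr1 // => x /andP[/andP[_ hx] _].
    by case: ifP => // /dvdn_leq; lia.
  rewrite [RHS]big_nat_recr //= -IHq.
  have -> : (q.+1 * m + m./2.+1 = (q * m + m./2.+1) + m)%N by lia.
  rewrite (big_cat_nat (leq0n _) (leq_addr m (q * m + m./2.+1))) //=; congr (_ * _).
  rewrite (big_cat_nat (n := q.+1 * m)) //=; try lia.
  rewrite [X in _ * X](big_cat_nat (n := (q.+1 * m).+1)) //=; try lia.
  rewrite big_nat1 dvdn_mull // mulnK // big_nat_cond big1 ?mul1r; last first.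
    move=> x /andP[/andP[h1 h2] _]; case: ifP => // /dvdnP[j jE'].
    have : (q < j)%N.
      rewrite -(ltn_pmul2r m_gt0) -jE'; apply: leq_trans h1.
      by rewrite addnS ltnS leq_addr.
    by rewrite ltnNge -ltnS -(ltn_pmul2r m_gt0) -jE' h2.
  rewrite big_nat_cond big1 ?mulr1 // => x /andP[/andP[h1 h2] _].
  case: ifP => // /dvdnP[j jE'].
  have : (q.+1 < j)%N by rewrite -(ltn_pmul2r m_gt0) -jE'.
  rewrite ltnNge -ltnS -(ltn_pmul2r m_gt0) -jE' (leq_trans h2) //.
  by rewrite !mulSn; lia.
have := big_mkord xpredT g => <-.
have -> : ((n * m)./2.+1 = n./2 * m + m./2.+1)%N by lia.
rewrite prod_periodic // [X in _ * X = _]big_mkord -jE.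
(* [g] is even modulo [m], trivial at 0 and squares to 1, so the factors at [x] and [m - x]
   cancel. *)
have -> : \prod_(0 <= x < m) g x = 1; last by rewrite expr1n mul1r.
have g_opp x y : (m %| x + y)%N -> g x = g y.
  move=> d; rewrite !gg' /g' -(dvdn_of_add d); case: ifP => // /negbT mx.
  have max : ~~ (m %| a * x)%N by rewrite Gauss_dvdr // coprime_sym.
  have mad : (m %| a * x + a * y)%N by rewrite -mulnDr dvdn_mull.
  by rewrite /g (half_sign_opp odd_m mx d) (half_sign_opp odd_m max mad) mulrNN.
have g0 : g 0%N = 1 by rewrite /g muln0 half_sign_sqr.
rewrite (big_cat_nat (leq0n _) le_m) /= big_nat_recl // g0 mul1r.
rewrite [X in _ * X](_ : _ = \prod_(0 <= x < m./2) g x.+1).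
  rewrite -big_split big1 // => x _ /=.
  by rewrite /g mulrACA !half_sign_sqr mulr1.
rewrite -{1}[m./2.+1]add0n big_addn big_nat_rev /=.
have -> : (m - m./2.+1 = m./2)%N by lia.
apply: eq_big_nat => x hx; apply: g_opp.
by rewrite (_ : (_ + _ + _ = m)%N) //; lia.
Qed.

Lemma odd_floor_double n y : odd n -> odd (2 * y %/ n) = (n < 2 * (y %% n))%N.
Proof.
move=> odd_n; have n_gt0 : (0 < n)%N by case: (n) odd_n.
rewrite {1}(divn_eq y n) mulnDr mulnA divnMDl // oddD oddM /=.
have := ltn_pmod y n_gt0; move: (y %% n)%N => r lt_r.
case: ltnP => h.
  by rewrite (_ : (2 * r %/ n = 1)%N) //; apply/eqP; rewrite eqn_leq -ltnS ltn_divLR // leq_divRL //; lia.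
by rewrite divn_small //; lia.
Qed.

Lemma big_sign (n : nat) (F : 'I_n -> nat) :
  \prod_(x < n) (-1) ^+ F x = (-1) ^+ (\sum_(x < n) F x)%N :> int.
Proof. by rewrite (big_morph (fun k => (-1 : int) ^+ k) (exprD _) (expr0 _)). Qed.

Lemma jacobi_sum a n : odd n ->
  jacobi a n = (-1) ^+ (\sum_(x < n./2.+1) (2 * (a * x) %/ n))%N.
Proof.
move=> odd_n; rewrite -big_sign; apply: eq_bigr => x _.
by rewrite /half_sign -odd_floor_double // signr_odd.
Qed.

(** Eisenstein's lattice point count: the floor of [2 a x / n] counts the [j] with [j n <= 2 a x],
    and the points are regrouped by [j]. Equality would make [a] divide [j < a]. *)
Lemma jacobi_lattice a n : (0 < a)%N -> odd n -> coprime a n ->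
  jacobi a n = (-1) ^+ (\sum_(1 <= j < a) (n./2 - j * n %/ (2 * a)))%N.
Proof.
move=> a_gt0 odd_n cop; rewrite jacobi_sum //; congr (_ ^+ _).
have n_gt0 : (0 < n)%N by case: (n) odd_n.
have count_lt k b : (k < b)%N -> (\sum_(1 <= j < b) (j <= k)%N = k)%N.
  elim: b k => [|b IHb] k; first by [].
  rewrite ltnS => le_kb.
  case: b IHb le_kb => [|b] IHb le_kb; first by rewrite big_geq //; lia.
  rewrite big_nat_recr //=; case: (ltnP k b.+1) => h; first by rewrite IHb //; move: h; case: leqP => //; lia.
  have -> : k = b.+1 by lia.
  rewrite addn1; congr S.
  rewrite (eq_big_nat _ _ (F2 := fun j => (j <= b)%N : nat)); last by move=> i hi; congr nat_of_bool; lia.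
  exact: IHb.
transitivity (\sum_(x < n./2.+1) \sum_(1 <= j < a) (j * n <= 2 * (a * x))%N)%N.
  apply: eq_bigr => x _; rewrite -[LHS](count_lt _ a).
    by apply: eq_bigr => j _; rewrite leq_divRL.
  rewrite ltn_divLR //; have := ltn_ord x.
  nia.
rewrite exchange_big /=; apply: eq_big_nat => j /andP[j1 j2].
have a2_gt0 : (0 < 2 * a)%N by lia.
have hj x : (j * n <= 2 * (a * x))%N = (j * n %/ (2 * a) < x)%N.
  rewrite ltn_divLR // leq_eqVlt.
  have -> : (j * n == 2 * (a * x))%N = false.
    apply/negP => /eqP E.
    have : (a %| j * n)%N by rewrite E mulnCA dvdn_mulr.
    rewrite Gauss_dvdl // => /dvdn_leq; lia.
  by rewrite /= mulnC mulnA (mulnC x).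
rewrite (eq_bigr (fun x : 'I__ => (j * n %/ (2 * a) < x)%N : nat)); last by move=> x _; rewrite hj.
elim: (n./2) => [|q IHq]; first by rewrite big_ord_recl big_ord0.
rewrite big_ord_recr /= IHq; lia.
Qed.

(** In [jacobi_lattice] the shift raises [n./2] by [2 a] and the floor at [j] by [2 j], so every
    term keeps its parity. *)
Lemma jacobi_period a n : (0 < a)%N -> odd n -> coprime a n -> jacobi a (n + 4 * a) = jacobi a n.
Proof.
move=> a_gt0 odd_n cop.
have odd_n' : odd (n + 4 * a) by lia.
have cop' : coprime a (n + 4 * a) by rewrite /coprime addnC gcdnMDl.
rewrite !jacobi_lattice // -signr_odd -[RHS]signr_odd; congr (_ ^+ nat_of_bool _).
rewrite [LHS](big_morph odd oddD (erefl _)) [RHS](big_morph odd oddD (erefl _)).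
apply: eq_big_nat => j /andP[j1 j2].
have -> : (j * (n + 4 * a) = 2 * j * (2 * a) + j * n)%N by lia.
rewrite divnMDl; last lia.
(* Needed because the subtraction is truncated. *)
have : (j * n %/ (2 * a) <= n./2)%N.
  by rewrite -ltnS ltn_divLR; nia.
lia.
Qed.

(* The quadratic character attached to the discriminant [- 4 N]. *)
Definition disc_char (N d : nat) : int :=
  if coprime (4 * N) d then (-1) ^+ d./2 * jacobi N d else 0.

Lemma coprime4 N d : coprime (4 * N) d = odd d && coprime N d.
Proof. by rewrite coprimeMl -[4%N]/(2 ^ 2)%N coprime_pexpl // coprime2n. Qed.

Lemma disc_char_mul N d e : disc_char N (d * e) = disc_char N d * disc_char N e.
Proof.
rewrite /disc_char coprimeMr.
case: (boolP (coprime (4 * N) d)) => /=; last by rewrite mul0r.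
case: (boolP (coprime (4 * N) e)) => /=; last by rewrite mulr0.
rewrite !coprime4 => /andP[oe ce] /andP[od cd].
rewrite jacobiMr //; last by rewrite coprimeMr cd.
rewrite mulrACA -exprD -signr_odd -[in RHS]signr_odd; congr (_ ^+ nat_of_bool _ * _).
have -> : d = (d./2 * 2 + 1)%N by lia.
have -> : e = (e./2 * 2 + 1)%N by lia.
move: d./2 e./2 => i j.
have -> : ((i * 2 + 1) * (j * 2 + 1))%N = ((i * j * 2 + i + j) * 2 + 1)%N by lia.
have h k : (k * 2 + 1)./2 = k by lia.
rewrite !h; have : ~~ odd (i * j * 2) by rewrite oddM andbF.
lia.
Qed.

Lemma disc_char_period N d : (0 < N)%N -> disc_char N (d + 4 * N) = disc_char N d.
Proof.
move=> N_gt0; rewrite /disc_char /coprime addnC -{2}[(4 * N)%N]mul1n gcdnMDl.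
case: ifP => // cop; have : coprime (4 * N) d by [].
rewrite coprime4 => /andP[od cd].
rewrite addnC jacobi_period //; congr (_ * _).
by rewrite -signr_odd -[RHS]signr_odd; congr (_ ^+ nat_of_bool _); lia.
Qed.

Lemma disc_char1 N : disc_char N 1 = 1.
Proof. by rewrite /disc_char coprimen1 expr0 mul1r jacobi_n1. Qed.

Lemma disc_char_sqr N d : disc_char N d * disc_char N d = (coprime (4 * N) d)%:R.
Proof.
rewrite /disc_char; case: ifP => _; last by rewrite mul0r.
by rewrite mulrACA jacobi_sqr mulr1 -expr2 sqrr_sign.
Qed.

Lemma disc_char_cases N d : [\/ disc_char N d = 0, disc_char N d = 1 | disc_char N d = -1].
Proof.
have := disc_char_sqr N d; case: (coprime _ _) => /eqP; last first.
  by rewrite mulf_eq0 orbb => /eqP; constructor 1.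
by rewrite -expr2 sqrf_eq1 => /orP[]/eqP; [constructor 2 | constructor 3].
Qed.

Lemma jacobi4 n : odd n -> jacobi 4 n = 1.
Proof.
move=> odd_n; have c2 : coprime 2 n by rewrite coprime2n.
by rewrite -[4%N]/(2 * 2)%N jacobiMl // jacobi_sqr.
Qed.

Lemma jacobi2_1mod8 j : jacobi 2 (8 * j + 1) = 1.
Proof.
rewrite jacobi_sum; last lia.
rewrite -signr_odd (_ : odd _ = false) //.
have -> : (8 * j + 1)./2.+1 = ((2 * j).+1 + 2 * j)%N by lia.
rewrite big_split_ord /= big1 ?add0n => [|i _]; last first.
  by rewrite divn_small //=; have := ltn_ord i; lia.
rewrite (eq_bigr (fun=> 1%N)) => [|i _]; last first.
  have := ltn_ord i; move: (i : nat) => k hk /=.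
  by apply/eqP; rewrite eqn_leq -ltnS ltn_divLR ?leq_divRL //; lia.
by rewrite sum_nat_const card_ord muln1; lia.
Qed.

(** The character is odd: [4 N - 1] is 3 modulo 4, which gives the sign, and [4 N] is 1 modulo
    [4 N - 1]. *)
Lemma disc_char_neg N : (0 < N)%N -> disc_char N (4 * N - 1) = -1.
Proof.
move=> N_gt0; set d := (4 * N - 1)%N.
have od : odd d by rewrite /d; lia.
have c4 : coprime (4 * N) d.
  rewrite /d -[X in coprime X _](@subnK 1); last lia.
  by rewrite addn1 coprimeSn.
have cN : coprime N d by move: c4; rewrite coprime4 => /andP[].
rewrite /disc_char c4 -signr_odd (_ : odd d./2); last by rewrite /d; lia.
have c4d : coprime 4 d by rewrite (@coprimeXl 2 2) // coprime2n.
have : jacobi (4 * N) d = 1.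
  rewrite (@jacobi_mod _ 1) ?jacobi1n //.
  have -> : (4 * N = d + 1)%N by rewrite /d; lia.
  by rewrite modnDl.
by rewrite jacobiMl // jacobi4 // mul1r => ->.
Qed.

(** This and the next two lemmas provide the class [a] for [sum3sq_of_class], with [delta * a] equal
    to -1 modulo [N]. Here [N] is 1 modulo [N - 1]. *)
Lemma disc_char_2mod4 N : (N %% 4 = 2)%N -> disc_char N (N - 1) = 1.
Proof.
move=> N2; set d := (N - 1)%N.
have od : odd d by rewrite /d; lia.
have cN : coprime N d.
  by rewrite /d -[X in coprime X _](@subnK 1) ?addn1 ?coprimeSn //; lia.
rewrite /disc_char coprime4 od cN -signr_odd (_ : odd d./2 = false); last by rewrite /d; lia.
rewrite mul1r (@jacobi_mod _ 1) ?jacobi1n //.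
have -> : (N = d + 1)%N by rewrite /d; lia.
by rewrite modnDl.
Qed.

(** [N - 1] is even here. As [2 N - 1] is 1 modulo 8, both 2 and [2 N] have symbol 1. *)
Lemma disc_char_1mod4 N : (N %% 4 = 1)%N -> disc_char N (2 * N - 1) = 1.
Proof.
move=> N1; set d := (2 * N - 1)%N.
have od : odd d by rewrite /d; lia.
have c2 : coprime 2 d by rewrite coprime2n.
have c2N : coprime (2 * N) d.
  by rewrite /d -[X in coprime X _](@subnK 1) ?addn1 ?coprimeSn //; lia.
have cN : coprime N d by move: c2N; rewrite coprimeMl => /andP[].
rewrite /disc_char coprime4 od cN -signr_odd (_ : odd d./2 = false); last by rewrite /d; lia.
have j1 : jacobi (2 * N) d = 1.
  rewrite (@jacobi_mod _ 1) ?jacobi1n //.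
  have -> : (2 * N = d + 1)%N by rewrite /d; lia.
  by rewrite modnDl.
have j2 : jacobi 2 d = 1.
  by rewrite -(jacobi2_1mod8 (N %/ 4)); congr jacobi; rewrite /d; lia.
by move: j1; rewrite jacobiMl // j2 !mul1r => ->.
Qed.

(** Twice [N./2] is [N - 1], so this class serves [delta = 2]. *)
Lemma disc_char_3mod8 N : (N %% 8 = 3)%N -> disc_char N (N./2) = 1.
Proof.
move=> N3; set d := N./2.
have od : odd d by rewrite /d; lia.
have NE : (N = 2 * d + 1)%N by rewrite /d; lia.
have cN : coprime N d by rewrite NE /coprime gcdnC gcdnMDl gcdn1.
rewrite /disc_char coprime4 od cN -signr_odd (_ : odd d./2 = false); last by rewrite /d; lia.
rewrite mul1r (@jacobi_mod _ 1) ?jacobi1n // NE.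
by rewrite modnMDl.
Qed.

(** Write [x] as [z ^ i] for a primitive root [z]; the hypothesis forces [i] to be even. *)
Lemma euler_criterion p (x : 'F_p) : prime p -> odd p -> x != 0 ->
  x ^+ p./2 = 1 -> exists z : 'F_p, x = z ^+ 2.
Proof.
move=> p_pr odd_p x0 xh.
have p_gt1 := prime_gt1 p_pr.
have pE : (p.-1 = 2 * p./2)%N by lia.
have unity (z : 'F_p) : z != 0 -> z ^+ p.-1 = 1.
  move=> z0; apply: (mulfI z0); rewrite mulr1 -exprS prednK ?prime_gt0 //.
  by have := expf_card z; rewrite card_Fp.
have : has p.-1.-primitive_root (enum (predC1 (0 : 'F_p))).
  apply: has_prim_root; first lia.
  - by apply/allP => z; rewrite mem_enum => z0; rewrite unity_rootE unity.
  - exact: enum_uniq.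
  - by rewrite -cardE cardC1 card_Fp.
case/hasP => z _ zP.
have [i] := prim_rootP zP (unity x x0); move: (nat_of_ord i) => {}i xE.
move: xh; rewrite xE -exprM => /eqP; rewrite -(prim_order_dvd zP) pE.
rewrite dvdn_pmul2r; last lia.
move=> /dvdnP[k ->]; by exists (z ^+ k); rewrite exprM.
Qed.

(** Gauss's lemma: multiplying a half system by [N] gives [N ^ p./2 = jacobi N p] in ['F_p]. With
    the sign in [disc_char] this reads [(- N) ^ p./2 = 1], and Euler's criterion applies. *)
Lemma disc_char_prime N p : prime p -> disc_char N p = 1 -> exists b : nat, (p %| b ^ 2 + N)%N.
Proof.
move=> p_pr; rewrite /disc_char; case: ifP => //; rewrite coprime4 => /andP[odd_p cN] disc_char1.
have p_gt1 := prime_gt1 p_pr.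
have chF : p \in [pchar 'F_p] by rewrite pchar_Fp.
have N0 : (N%:R : 'F_p) != 0.
  by rewrite -(dvdn_pcharf chF) -prime_coprime // coprime_sym.
(* The value 1 at multiples of [p] lets the factor at [x = 0] be cancelled. *)
pose c x : 'F_p := if (p %| x)%N then 1 else (half_sign p x)%:~R * x%:R.
have c_mod x : c (x %% p)%N = c x.
  rewrite /c half_sign_mod {1}/dvdn modn_mod -/(dvdn p x).
  have -> // : (x %% p)%:R = x%:R :> 'F_p.
  by rewrite [in RHS](divn_eq x p) natrD natrM (pcharf0 chF) mulr0 add0r.
have c_opp x y : (p %| x + y)%N -> c x = c y.
  move=> d; rewrite /c -(dvdn_of_add d); case: ifP => // /negbT px.
  rewrite (half_sign_opp odd_p px d); have : (x + y)%:R = 0 :> 'F_p.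
    by apply/eqP; rewrite -(dvdn_pcharf chF).
  by rewrite natrD => /eqP; rewrite addr_eq0 => /eqP ->; rewrite mulrN rmorphN /= mulNr.
have nd (x : 'I_p./2) : ~~ (p %| x.+1)%N.
  by apply/negP => /dvdn_leq; have := ltn_ord x; lia.
have := prod_half_system odd_p cN c_mod c_opp.
rewrite !big_ord_recl muln0 /=.
have E x : c (N * (bump 0 (x : 'I_p./2)))%N =
    (half_sign p (N * bump 0 x))%:~R * N%:R * c (bump 0 x).
  have hx := ltn_ord x.
  have pN : (p %| N)%N = false by apply/negbTE; rewrite -prime_coprime // coprime_sym.
  rewrite /c /bump add1n (negbTE (nd x)) Euclid_dvdM // (negbTE (nd x)) pN /=.
  rewrite (@half_sign_small p x.+1) //.
  by rewrite natrM rmorph1 mul1r mulrA.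
have c0 : c 0%N != 0 by rewrite /c dvdn0 oner_eq0.
move/(mulfI c0); rewrite (eq_bigr _ (fun x _ => E x)) big_split /=.
have Q0 : \prod_(x < p./2) c (bump 0 x) != 0.
  apply/prodf_neq0 => x _; have hx := ltn_ord x.
  rewrite /c /bump add1n (negbTE (nd x)) half_sign_small // rmorph1 mul1r.
  by rewrite -(dvdn_pcharf chF) nd.
rewrite -[RHS]mul1r => /(mulIf Q0).
rewrite big_split /= prodr_const card_ord.
rewrite -(rmorph_prod (intmul 1)) /=.
have -> : \prod_(x < p./2) half_sign p (N * bump 0 x) = jacobi N p.
  rewrite [RHS]big_ord_recl muln0 (@half_sign_small p 0) // mul1r.
  by apply: eq_bigr => x _; rewrite lift0.
have -> : jacobi N p = (-1) ^+ p./2.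
  by apply: (@mulfI _ ((-1) ^+ p./2)); rewrite ?signr_eq0 // disc_char1 -expr2 sqrr_sign.
rewrite rmorphXn rmorphN1 -exprMn mulN1r => e.
have [|z zE] := euler_criterion p_pr odd_p _ e; first by rewrite oppr_eq0.
exists (z : nat); rewrite (dvdn_pcharf chF) natrD natrX natr_Zp -zE.
by rewrite addNr.
Qed.

(** * Ternary forms of determinant 1 *)

Definition sum3sq (m : int) : Prop :=
  exists x y z : int, m = x ^+ 2 + y ^+ 2 + z ^+ 2.

Lemma centered_residue (a b : int) : 0 < a ->
  exists k : int, (2 * (b + k * a) <= a) && (- a <= 2 * (b + k * a)).
Proof.
move=> a_gt0.
exists (- ((2 * b + a) %/ (2 * a))%Z).
have e := divz_eq (2 * b + a) (2 * a).
have l : ((2 * b + a) %% (2 * a))%Z < 2 * a by apply: ltz_pmod; lia.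
have m0 : 0 <= ((2 * b + a) %% (2 * a))%Z by apply: modz_ge0; lia.
set q := (_ %/ _)%Z in e *; set r := (_ %% _)%Z in e l m0.
apply/andP; split; nia.
Qed.

(** Unless [3 A ^ 2 <= 4 D], a shift to [2 |B'| <= A] gives [A C' = D + B' ^ 2 < A ^ 2], and
    exchanging the variables lowers the leading coefficient. *)
Lemma binary_reduction (A B C D : int) : 0 < A -> 0 < D -> A * C - B ^+ 2 = D ->
  exists p q u v : int, [/\ p * v - q * u = 1,
    0 < A * p ^+ 2 + 2 * B * p * u + C * u ^+ 2 &
    3 * (A * p ^+ 2 + 2 * B * p * u + C * u ^+ 2) ^+ 2 <= 4 * D].
Proof.
move=> A_gt0 D_gt0.
have [n leAn] : exists n : nat, A <= n%:Z by exists `|A|%N; lia.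
elim: n => [|n IHn] in A B C A_gt0 leAn * => detE; first lia.
case: (lerP (3 * A ^+ 2) (4 * D)) => [small|big].
  by exists 1, 0, 0, 1; split; rewrite ?expr1n ?mulr1 ?mulr0 ?expr0n ?addr0 //=; lia.
have [k /andP[k1 k2]] := centered_residue B A_gt0.
set B' := B + k * A in k1 k2.
pose C' := C + 2 * k * B + k ^+ 2 * A.
have det' : A * C' - B' ^+ 2 = D by rewrite -detE /C' /B'; ring.
have C'_gt0 : 0 < C' by nia.
have C'_lt : C' < A by nia.
have [||p [q [u [v [d1 pos le]]]]] := IHn C' (- B') A C'_gt0 _ _.
- lia.
- by rewrite -det'; ring.
exists (k * p - u), (k * q - v), p, q.
have E : A * (k * p - u) ^+ 2 + 2 * B * (k * p - u) * p + C * p ^+ 2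
  = C' * p ^+ 2 + 2 * - B' * p * u + A * u ^+ 2 by rewrite /C' /B'; ring.
by rewrite E; split => //; rewrite -d1; ring.
Qed.

(** Reduction gives [3 A' ^ 2 <= 4], so [A' = 1]; then complete the square. *)
Lemma binary_det1 (A B C y z : int) : 0 < A -> A * C - B ^+ 2 = 1 ->
  exists v w : int, A * y ^+ 2 + 2 * B * y * z + C * z ^+ 2 = v ^+ 2 + w ^+ 2.
Proof.
move=> A_gt0 detE.
have [p [q [u [v [d1 pos le]]]]] := binary_reduction A_gt0 ltr01 detE.
pose A' := A * p ^+ 2 + 2 * B * p * u + C * u ^+ 2.
pose B' := A * p * q + B * (p * v + q * u) + C * u * v.
pose C' := A * q ^+ 2 + 2 * B * q * v + C * v ^+ 2.
have A'1 : A' = 1 by rewrite /A'; nia.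
have det' : A' * C' - B' ^+ 2 = 1.
  have -> : A' * C' - B' ^+ 2 = (A * C - B ^+ 2) * (p * v - q * u) ^+ 2.
    by rewrite /A' /B' /C'; ring.
  by rewrite detE d1 expr1n mulr1.
pose y' := v * y - q * z; pose z' := p * z - u * y.
exists (y' + B' * z'), z'.
have -> : A * y ^+ 2 + 2 * B * y * z + C * z ^+ 2 =
    A' * y' ^+ 2 + 2 * B' * y' * z' + C' * z' ^+ 2.
  have -> : A' * y' ^+ 2 + 2 * B' * y' * z' + C' * z' ^+ 2 =
     (A * y ^+ 2 + 2 * B * y * z + C * z ^+ 2) * (p * v - q * u) ^+ 2.
    by rewrite /A' /B' /C' /y' /z'; ring.
  by rewrite d1 expr1n mulr1.
have -> : C' = 1 + B' ^+ 2 by rewrite -det' A'1; ring.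
by rewrite A'1; ring.
Qed.

Definition ternary (a b c r s t x y z : int) : int :=
  a * x ^+ 2 + b * y ^+ 2 + c * z ^+ 2
  + 2 * r * y * z + 2 * s * x * z + 2 * t * x * y.

Definition ternary_det (a b c r s t : int) : int :=
  a * b * c + 2 * r * s * t - a * r ^+ 2 - b * s ^+ 2 - c * t ^+ 2.

(** Gauss's descent on [a]: reducing the projected form, of determinant [a], yields a leading minor
    [d] with [3 d ^ 2 <= 4 a]; reducing the leading binary form then yields [a1] with
    [3 a1 ^ 2 <= 4 d]. For [a > 1] this forces [a1 < a]. *)
Lemma ternary_det1 (a b c r s t x y z : int) :
  0 < a -> 0 < a * b - t ^+ 2 -> ternary_det a b c r s t = 1 ->
  sum3sq (ternary a b c r s t x y z).
Proof.
have [n leAn] : exists n : nat, a <= n%:Z by exists `|a|%N; lia.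
elim: n => [|n IHn] in a b c r s t x y z leAn * => a_gt0 d_gt0 detE; first lia.
(* The projection of the form along its first basis vector. *)
have detP : (a * b - t ^+ 2) * (a * c - s ^+ 2) - (a * r - t * s) ^+ 2 = a.
  by rewrite -[RHS]mulr1 -detE /ternary_det; ring.
have [p [q [u [v [d1 pos le]]]]] := binary_reduction d_gt0 a_gt0 detP.
pose b1 := b * p ^+ 2 + 2 * r * p * u + c * u ^+ 2.
pose c1 := b * q ^+ 2 + 2 * r * q * v + c * v ^+ 2.
pose r1 := b * p * q + r * (p * v + q * u) + c * u * v.
pose t1 := t * p + s * u; pose s1 := t * q + s * v.
pose y1 := v * y - q * z; pose z1 := p * z - u * y.
have EF : ternary a b c r s t x y z = ternary a b1 c1 r1 s1 t1 x y1 z1.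
  have -> : ternary a b1 c1 r1 s1 t1 x y1 z1 =
      ternary a b c r s t x ((p * v - q * u) * y) ((p * v - q * u) * z).
    by rewrite /ternary /b1 /c1 /r1 /t1 /s1 /y1 /z1; ring.
  by rewrite d1 !mul1r.
have det1 : ternary_det a b1 c1 r1 s1 t1 = 1.
  have -> : ternary_det a b1 c1 r1 s1 t1 =
      ternary_det a b c r s t * (p * v - q * u) ^+ 2.
    by rewrite /ternary_det /b1 /c1 /r1 /t1 /s1; ring.
  by rewrite detE d1 expr1n mulr1.
have dE : a * b1 - t1 ^+ 2 = (a * b - t ^+ 2) * p ^+ 2
   + 2 * (a * r - t * s) * p * u + (a * c - s ^+ 2) * u ^+ 2.
  by rewrite /b1 /t1; ring.
rewrite -dE in pos le.
have [p2 [q2 [u2 [v2 [d2 pos2 le2]]]]] := binary_reduction a_gt0 pos erefl.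
rewrite EF; move: (b1) (c1) (r1) (s1) (t1) (y1) (z1) det1 pos le pos2 le2 => {EF dE detE d_gt0 detP d1}.
move: (p2) (q2) (u2) (v2) d2 => {p q u v p2 q2 u2 v2 b1 c1 r1 s1 t1 y1 z1 b c r s t y z}.
move=> p q u v d1 b c r s t y z detE d_gt0 le_d pos2 le2.
have [a1|a_neq1] := eqVneq a 1.
  subst a; rewrite !mul1r in d_gt0 le_d.
  have [||w1 [w2 w12]] := @binary_det1 (b - t ^+ 2) (r - s * t) (c - s ^+ 2) y z.
  - lia.
  - by rewrite -detE /ternary_det; ring.
  exists (x + t * y + s * z), w1, w2; rewrite -addrA -w12 /ternary; ring.
pose a1 := a * p ^+ 2 + 2 * t * p * u + b * u ^+ 2.
pose b1 := a * q ^+ 2 + 2 * t * q * v + b * v ^+ 2.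
pose t1 := a * p * q + t * (p * v + q * u) + b * u * v.
pose s1 := s * p + r * u; pose r1 := s * q + r * v.
pose x1 := v * x - q * y; pose y1 := p * y - u * x.
have -> : ternary a b c r s t x y z = ternary a1 b1 c r1 s1 t1 x1 y1 z.
  have -> : ternary a1 b1 c r1 s1 t1 x1 y1 z =
      ternary a b c r s t ((p * v - q * u) * x) ((p * v - q * u) * y) z.
    by rewrite /ternary /a1 /b1 /r1 /t1 /s1 /x1 /y1; ring.
  by rewrite d1 !mul1r.
have d1E : a1 * b1 - t1 ^+ 2 = a * b - t ^+ 2.
  have -> : a1 * b1 - t1 ^+ 2 = (a * b - t ^+ 2) * (p * v - q * u) ^+ 2.
    by rewrite /a1 /b1 /t1; ring.
  by rewrite d1 expr1n mulr1.
apply: IHn => //; last first.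
- have -> : ternary_det a1 b1 c r1 s1 t1 =
      ternary_det a b c r s t * (p * v - q * u) ^+ 2.
    by rewrite /ternary_det /a1 /b1 /r1 /t1 /s1; ring.
  by rewrite detE d1 expr1n mulr1.
- by rewrite d1E.
suff : a1 < a by lia.
have {}le2 : 3 * a1 ^+ 2 <= 4 * (a * b - t ^+ 2) by [].
clear -le2 le_d a_neq1 a_gt0 d_gt0 pos2.
move: (a * b - t ^+ 2) d_gt0 le_d le2 => d d_gt0 le_d le2.
rewrite ltNge; apply/negP => le_a.
have h1 : 3 * a ^+ 2 <= 4 * d by nia.
have h2 : 2 <= a by lia.
have h3 : d < a by nia.
nia.
Qed.

(* [e1 * X + e2 * Y] is chosen so that [n X^2 + 2 b X Y + l Y^2] plus its square
   is divisible by [N]; then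
   [(n X^2 + 2 b X Y + l Y^2 + (e1 X + e2 Y + N Z)^2) / N]
   is an integral form of determinant 1 with value [N] at [(0, 0, 1)]. *)
Lemma sum3sq_of_residues (N n b c : int) :
  0 < N -> 0 < n -> coprimez n N ->
  (n %| b ^+ 2 + N)%Z -> (N %| c ^+ 2 + n)%Z -> sum3sq N.
Proof.
move=> N_gt0 n_gt0 cop /dvdzP[l lE] /dvdzP[a aE].
have [m [k]] := Bezoutz n N; rewrite (eqP cop) => mk.
have kN : k * N = 1 - m * n by rewrite -mk; ring.
have NE : N = l * n - b ^+ 2 by rewrite -lE; ring.
(* Here [e1 = c]. Modulo [N], [m] inverts [n] and [c ^ 2] is [- n], so [c * e2] is [- b]. *)
pose e2 := c * b * m.
have tE : b + c * e2 = (k * b + a * b * m) * N.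
  have -> : (k * b + a * b * m) * N = b * (k * N) + b * m * (a * N) by ring.
  by rewrite -aE kN /e2; ring.
have lE' : l = k * l * N + m * (b ^+ 2 + N).
  by rewrite lE -[LHS]mulr1 -mk; ring.
have bE : l + e2 ^+ 2 = (k * l + m + m * b ^+ 2 * k + a * m ^+ 2 * b ^+ 2) * N.
  have -> : (k * l + m + m * b ^+ 2 * k + a * m ^+ 2 * b ^+ 2) * N
    = k * l * N + m * N + m * b ^+ 2 * (k * N) + m ^+ 2 * b ^+ 2 * (a * N) by ring.
  by rewrite -aE {1}lE' kN /e2; ring.
move: (k * b + a * b * m) (k * l + m + _ + _) tE bE => t b' tE bE.
have N_neq0 : N != 0 by lia.
have key : N ^+ 2 * (a * b' - t ^+ 2) = N + (n * e2 ^+ 2 + l * c ^+ 2 - 2 * b * c * e2).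
  have -> : N ^+ 2 * (a * b' - t ^+ 2) = (a * N) * (b' * N) - (t * N) ^+ 2 by ring.
  by rewrite -aE -bE -tE -[N in RHS](addKr (b ^+ 2)) lE; ring.
(* A value of the binary form with coefficients [n], [b], [l], of determinant [N]; it makes the
   leading minor positive. *)
have psd : 0 <= n * (n * e2 ^+ 2 + l * c ^+ 2 - 2 * b * c * e2).
  have -> : n * (n * e2 ^+ 2 + l * c ^+ 2 - 2 * b * c * e2)
   = (n * e2 - b * c) ^+ 2 + N * c ^+ 2.
    by rewrite NE; ring.
  by rewrite addr_ge0 ?sqr_ge0 // mulr_ge0 ?sqr_ge0 // ltW.
rewrite (pmulr_rge0 _ n_gt0) in psd.
have -> : N = ternary a b' N e2 c t 0 0 1 by rewrite /ternary; ring.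
apply: ternary_det1.
- by rewrite -(pmulr_lgt0 _ N_gt0) -aE ltr_wpDl ?sqr_ge0.
- by rewrite -(pmulr_rgt0 _ (exprn_gt0 2 N_gt0)) key ltr_wpDr.
apply: (mulfI (_ : N ^+ 2 != 0)); first by rewrite expf_eq0.
have -> : N ^+ 2 * ternary_det a b' N e2 c t = N * ((a * N) * (b' * N)
   + 2 * c * e2 * (t * N) - (a * N) * e2 ^+ 2 - (b' * N) * c ^+ 2 - (t * N) ^+ 2).
  by rewrite /ternary_det; ring.
by rewrite -aE -bE -tE NE; ring.
Qed.

(** * Sums of three squares *)

(** Reflecting the period multiplies [d] by [4 N - 1] modulo [4 N], where the character is -1. *)
Lemma disc_char_sum N : (0 < N)%N -> \sum_(0 <= d < 4 * N) disc_char N d = 0.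
Proof.
move=> N_gt0; have D_gt0 : (0 < 4 * N)%N by lia.
rewrite big_ltn // {1}/disc_char /coprime gcdn0 (_ : (_ == 1)%N = false) ?add0r; last lia.
have per q d : disc_char N (q * (4 * N) + d) = disc_char N d.
  elim: q => // q IHq.
  by rewrite mulSn -addnA addnC disc_char_period.
set S := \sum_(_ <= _ < _) _.
suff : S = - S by move=> h; lia.
rewrite {1}/S big_nat_rev -sumrN; apply: eq_big_nat => d /andP[d1 d2] /=.
rewrite -[RHS]mulN1r -(disc_char_neg N_gt0) -disc_char_mul.
have -> : ((4 * N - 1) * d = (d - 1) * (4 * N) + (1 + 4 * N - d.+1))%N by nia.
by rewrite per.
Qed.

Lemma Posz_sqr (n : nat) : (n ^ 2)%N%:Z = n%:Z ^+ 2.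
Proof. by rewrite -mulnn PoszM expr2. Qed.

(** Some [n = m ^ 2 * l] in the class of [a] has [- N] a square modulo [l], hence modulo
    [delta * l], while [- delta * l] is a square modulo [N]; this is the input of
    [sum3sq_of_residues]. *)
Lemma sum3sq_of_class (N delta a : nat) : (0 < N)%N -> (0 < delta)%N ->
  coprime delta N -> (N %| delta * a + 1)%N -> disc_char N a = 1 ->
  (forall l b, odd l -> (l %| b ^ 2 + N)%N ->
     exists b, (delta * l %| b ^ 2 + N)%N) ->
  sum3sq N%:Z.
Proof.
move=> N_gt0 delta_gt0 cop_delta Na char_a lift.
(* [divisor_sum_residue_class] only refutes that all sums vanish, hence the argument by
   contradiction. *)
apply: NNPP => not3.
pose psi d : rat := (disc_char N d)%:~R.
have psiM d e : psi (d * e)%N = psi d * psi e by rewrite /psi disc_char_mul rmorphM.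
have psi1 : psi 1%N = 1 by rewrite /psi disc_char1.
have psi_cases d : [\/ psi d = 0, psi d = 1 | psi d = -1].
  by rewrite /psi; case: (disc_char_cases N d) => ->; [constructor 1|constructor 2|constructor 3].
have psi_sqr d : psi d * psi d = (coprime (4 * N) d)%:R.
  by rewrite /psi -rmorphM /= disc_char_sqr rmorph_nat.
have psi_per d : psi (d + 4 * N)%N = psi d by rewrite /psi disc_char_period.
have psi_sum : \sum_(0 <= d < 4 * N) psi d = 0.
  by rewrite /psi -rmorph_sum disc_char_sum.
have D_gt0 : (0 < 4 * N)%N by lia.
have ds_ge0 := divisor_sum_ge0 psi1 psiM psi_cases.
have ds_sqr := divisor_sum_sqr psi1 psiM psi_cases.
have psia : psi a = 1 by rewrite /psi char_a.
apply: (divisor_sum_residue_class D_gt0 psi_per psi_sum psiM psi_sqr ds_ge0 ds_sqr psia).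
move=> n n_gt0 na; apply/eqP/negPn/negP => nz; apply: not3.
have per q d : disc_char N (q * (4 * N) + d) = disc_char N d.
  by elim: q => // q IHq; rewrite mulSn -addnA addnC disc_char_period.
have char_n : disc_char N n = 1 by rewrite (divn_eq n (4 * N)) per na -(per (a %/ (4 * N))%N) -divn_eq.
have cop_n : coprime (4 * N) n.
  by apply/negPn/negP => h; have := disc_char_sqr N n; rewrite char_n (negbTE h).
have nz_div d : (d %| n)%N -> psi d != 0.
  move=> /dvdnP[e nE]; rewrite /psi intr_eq0; apply/eqP => d0.
  by move: char_n; rewrite nE disc_char_mul d0 mulr0.
have [m [l [nE Hl]]] := divisor_sum_neq0 psi1 psiM psi_cases n_gt0 nz_div nz.
move: cop_n; rewrite coprime4 nE oddM coprimeMr => /andP[/andP[_ odd_l] /andP[cop_m cop_l]].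
have [b0 b0E] : exists b, (l %| b ^ 2 + N)%N.
  apply: Hl => p p_pr pp; apply: disc_char_prime => //.
  by apply: (@intr_inj rat); rewrite -/(psi p) pp.
have [b bE] := lift l b0 odd_l b0E.
have [u [v uv]] : exists u v : int, u * m%:Z + v * N%:Z = 1.
  have [u [v uv]] := Bezoutz m N; exists u, v; rewrite uv.
  apply/eqP; change (coprimez m N); rewrite coprimezE /= coprime_sym.
  by move: cop_m; rewrite coprime_pexpr.
apply: (@sum3sq_of_residues N (delta * l)%N b u) => //.
- by move: odd_l; rewrite ltz_nat muln_gt0 delta_gt0; case: (l).
(* What remains is that [u], the inverse of [m], is the root sought: modulo [N],
   [m ^ 2 * (u ^ 2 + delta * l)] is [1 + delta * a], that is 0. *)
- by rewrite coprimezE /= coprimeMl cop_delta coprime_sym.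
have [k kE] := dvdnP Na.
have [q qE] : exists q : int, n%:Z = a%:Z + q * N%:Z.
  exists ((n %/ (4 * N))%:Z * 4 - (a %/ (4 * N))%:Z * 4).
  have := divn_eq n (4 * N); have := divn_eq a (4 * N); rewrite na.
  move: (n %/ _)%N (a %/ _)%N (a %% _)%N => i j r -> ->.
  by rewrite !PoszD !PoszM; ring.
have key : m%:Z ^+ 2 * l%:Z = n%:Z by rewrite nE PoszM Posz_sqr.
rewrite -(@Gauss_dvdzr N (m ^ 2)%N); last first.
  by rewrite coprimezE /= coprime_pexpr // -(coprime_pexpr N m (isT : (0 < 2)%N)).
apply/dvdzP; exists (v ^+ 2 * N%:Z - 2 * v + k%:Z + delta%:Z * q).
have -> : (m ^ 2)%N%:Z * (u ^+ 2 + (delta * l)%N) = (u * m%:Z) ^+ 2 + delta%:Z * (m%:Z ^+ 2 * l%:Z).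
  by rewrite Posz_sqr PoszM; ring.
have -> : u * m%:Z = 1 - v * N%:Z by rewrite -uv; ring.
have kE' : delta%:Z * a%:Z + 1 = k%:Z * N%:Z by rewrite -PoszM -[1]/(Posz 1) -PoszD kE PoszM.
rewrite key qE.
have -> : (1 - v * N%:Z) ^+ 2 + delta%:Z * (a%:Z + q * N%:Z) =
   (delta%:Z * a%:Z + 1) + (v ^+ 2 * N%:Z - 2 * v + delta%:Z * q) * N%:Z by ring.
rewrite kE'; ring.
Qed.

Lemma sum3sq_1mod4 N : (N %% 4 = 1)%N -> sum3sq N%:Z.
Proof.
move=> N1; apply: (@sum3sq_of_class N 1 (2 * N - 1)) => //; try lia.
- by rewrite coprime1n.
- by rewrite mul1n subnK ?dvdn_mull //; lia.
- exact: disc_char_1mod4.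
- by move=> l b _ h; exists b; rewrite mul1n.
Qed.

Lemma sum3sq_2mod4 N : (N %% 4 = 2)%N -> sum3sq N%:Z.
Proof.
move=> N2; apply: (@sum3sq_of_class N 1 (N - 1)) => //; try lia.
- by rewrite coprime1n.
- by rewrite mul1n subnK //; lia.
- exact: disc_char_2mod4.
- by move=> l b _ h; exists b; rewrite mul1n.
Qed.

Lemma sum3sq_3mod8 N : (N %% 8 = 3)%N -> sum3sq N%:Z.
Proof.
move=> N3; apply: (@sum3sq_of_class N 2 N./2) => //; try lia.
- by rewrite coprime2n; lia.
- by rewrite (_ : (_ + _ = N)%N) //; lia.
- exact: disc_char_3mod8.
move=> l b odd_l h.
(* An odd [b] makes [b ^ 2 + N] even, and adding the odd [l] changes the parity of [b]. *)
exists (if odd b then b else b + l)%N.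
rewrite Gauss_dvd ?coprime2n //; apply/andP; split.
  have oN : odd N by lia.
  by case: ifP => ob; rewrite dvdn2 oddD oddX /= ?oddD ?ob ?odd_l oN.
by case: ifP => // _; rewrite /dvdn -modnDml -modnXm modnDr modnXm modnDml.
Qed.

(** * Sums of octagonal numbers *)

Lemma mod3_cases (x : int) : exists k, [\/ x = 3 * k, x = 3 * k + 1 | x = 3 * k - 1].
Proof.
exists ((x + 1) %/ 3)%Z; have := divz_eq (x + 1) 3.
have : 0 <= ((x + 1) %% 3)%Z < 3 by rewrite modz_ge0 // ltz_pmod.
move: ((x + 1) %% 3)%Z ((x + 1) %/ 3)%Z => r q hr e.
have [r0|[r1|r2]] : r = 0 \/ r = 1 \/ r = 2 by lia.
- by constructor 3; lia.
- by constructor 1; lia.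
- by constructor 2; lia.
Qed.

Lemma P8_complete (X : int) : ~~ (3 %| X)%Z -> exists x, 3 * P8 x + 1 = X ^+ 2.
Proof.
case: (mod3_cases X) => k [] -> h.
- by case/negP: h; rewrite dvdz_mulr.
- by exists (- k); rewrite /P8; ring.
- by exists k; rewrite /P8; ring.
Qed.

Lemma unit_sqr_mod3 (x : int) : ~~ (3 %| x)%Z -> exists k, x ^+ 2 = 3 * k + 1.
Proof.
case: (mod3_cases x) => k [] -> h.
- by case/negP: h; rewrite dvdz_mulr.
- by exists (3 * k ^+ 2 + 2 * k); ring.
- by exists (3 * k ^+ 2 - 2 * k); ring.
Qed.

Lemma nonunit_sqr_mod9 (x : int) : (3 %| x)%Z -> exists k, x ^+ 2 = 9 * k.
Proof. by case/dvdzP => k ->; exists (k ^+ 2); ring. Qed.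

(* If all three squares are divisible by 3, the integral matrix
   [(2, 2, -1), (2, -1, 2), (-1, 2, 2)], which is 3 times an isometry, produces
   from a representation of [m / 9] one of [m] with entries prime to 3. *)
Lemma sum3sq_primitive_at3 (m : int) : 0 < m -> sum3sq m ->
  exists x y z : int, m = x ^+ 2 + y ^+ 2 + z ^+ 2 /\
    ~~ ((3 %| x)%Z && (3 %| y)%Z && (3 %| z)%Z).
Proof.
have [n lemn] : exists n : nat, m <= n%:Z by exists `|m|%N; lia.
elim: n => [|n IHn] in m lemn * => m_gt0 [x [y [z mE]]]; first lia.
case: (boolP ((3 %| x)%Z && (3 %| y)%Z && (3 %| z)%Z)); last by exists x, y, z.
case/andP => /andP[/dvdzP[x1 x1E] /dvdzP[y1 y1E]] /dvdzP[z1 z1E].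
have m9 : m = 9 * (x1 ^+ 2 + y1 ^+ 2 + z1 ^+ 2) by rewrite mE x1E y1E z1E; ring.
have [|||x2 [y2 [z2 [m1E nd]]]] := IHn (x1 ^+ 2 + y1 ^+ 2 + z1 ^+ 2).
- by move: (_ + z1 ^+ 2) m9 lemn m_gt0 => s; clear; lia.
- by move: (_ + z1 ^+ 2) m9 m_gt0 => s; clear; lia.
- by exists x1, y1, z1.
have {mE x1E y1E z1E m9 m1E} mE : m = 9 * (x2 ^+ 2 + y2 ^+ 2 + z2 ^+ 2).
  by rewrite -m1E.
(* If every choice of signs gave a sum divisible by 3, then 3 would divide all three entries. *)
have [a [b [c [abc aE]]]] : exists a b c : int,
    a ^+ 2 + b ^+ 2 + c ^+ 2 = x2 ^+ 2 + y2 ^+ 2 + z2 ^+ 2 /\ ~~ (3 %| a + b + c)%Z.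
  case: (boolP (3 %| x2 + y2 + z2)%Z) => h1; last by exists x2, y2, z2.
  case: (boolP (3 %| x2 + y2 - z2)%Z) => h2; last by exists x2, y2, (- z2); split; first ring.
  case: (boolP (3 %| x2 - y2 + z2)%Z) => h3; last by exists x2, (- y2), z2; split; first ring.
  exfalso; move: nd h1 h2 h3 => {}/negP nd /dvdzP[i i1] /dvdzP[j j1] /dvdzP[k k1].
  by apply: nd; rewrite -!andbA; apply/and3P; split; apply/dvdzP;
    [exists (x2 - j - k) | exists (y2 - i + k) | exists (z2 - i + j)]; lia.
exists (2 * a + 2 * b - c), (2 * a - b + 2 * c), (- a + 2 * b + 2 * c).
split; first by rewrite mE -abc; ring.
rewrite !negb_and; apply/orP; left; apply/orP; left.
apply: contra aE => /dvdzP[k kE]; apply/dvdzP; exists (a + b - k).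
by clear -kE; lia.
Qed.

(* With [X = p + 2 s] and [Y = p - s] one has [X^2 + 2 Y^2 = 3 (p^2 + 2 s^2)]. *)
Definition octagonal_good (K : int) : Prop := exists p z s : int,
  [/\ p ^+ 2 + z ^+ 2 + 2 * s ^+ 2 = K, ~~ (3 %| z)%Z & ~~ ((3 %| p)%Z && (3 %| s)%Z)].

(** [p + 2 s] and [p - s] agree modulo 3, so it suffices that 3 does not divide [p - s]; otherwise
    [s] changes sign, since 3 cannot divide both [p - s] and [p + s]. *)
Lemma octagonal_good_rep (K T : int) (c n : int) : octagonal_good K ->
  ~~ (3 %| T)%Z -> 3 * K + c * T ^+ 2 = 3 * n + (6 + c) ->
  exists x y z t : int, P8 x + 2 * P8 y + 3 * P8 z + c * P8 t = n.
Proof.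
case=> p [z [s [KE z3 ps]]] T3 E.
have [X [Y [XY X3 Y3]]] : exists X Y : int, [/\ X ^+ 2 + 2 * Y ^+ 2 = 3 * (p ^+ 2 + 2 * s ^+ 2),
    ~~ (3 %| X)%Z & ~~ (3 %| Y)%Z].
  case: (boolP (3 %| p - s)%Z) => h; last first.
    exists (p + 2 * s), (p - s); split => //; first ring.
    by apply: contra h => /dvdzP[k kE]; apply/dvdzP; exists (k - s); lia.
  have h2 : ~~ (3 %| p + s)%Z.
    apply: contra ps => /dvdzP[i iE]; move: h => /dvdzP[j jE].
    apply/andP; split; apply/dvdzP; [exists (2 * (i + j) - p) | exists (2 * (i - j) - s)]; lia.
  exists (p - 2 * s), (p + s); split => //; first ring.
  by apply: contra h2 => /dvdzP[k kE]; apply/dvdzP; exists (k + s); lia.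
have [x xE] := P8_complete X3; have [y yE] := P8_complete Y3.
have [z' zE] := P8_complete z3; have [t tE] := P8_complete T3.
exists x, y, z', t.
apply: (@mulfI _ 3) => //.
have -> : 3 * (P8 x + 2 * P8 y + 3 * P8 z' + c * P8 t) = (3 * P8 x + 1)
  + 2 * (3 * P8 y + 1) + 3 * (3 * P8 z' + 1) + c * (3 * P8 t + 1) - (6 + c) by ring.
rewrite xE yE zE tE XY.
have -> : 3 * (p ^+ 2 + 2 * s ^+ 2) + 3 * z ^+ 2 + c * T ^+ 2 - (6 + c) = 3 * K + c * T ^+ 2 - (6 + c).
  by rewrite -KE; ring.
by rewrite E; ring.
Qed.

Lemma sqr_mod4 (x : int) : exists k j : int,
  (x = 2 * k /\ x ^+ 2 = 4 * j) \/ (x = 2 * k + 1 /\ x ^+ 2 = 4 * j + 1).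
Proof.
exists (x %/ 2)%Z; have := divz_eq x 2; have : 0 <= (x %% 2)%Z < 2 by rewrite modz_ge0 // ltz_pmod.
move: (x %% 2)%Z (x %/ 2)%Z => r q hr e.
have [r0|r1] : r = 0 \/ r = 1 by lia.
- by exists (q ^+ 2); left; rewrite e r0; split; ring.
- by exists (q ^+ 2 + q); right; rewrite e r1; split; ring.
Qed.

(** The sum is even, so none or two of the entries are odd: two share a parity and the third is
    even. *)
Lemma sum3sq_double_split (K A B C : int) : 2 * K = A ^+ 2 + B ^+ 2 + C ^+ 2 ->
  exists x y s : int, [\/ [/\ A = x + y, B = x - y & C = 2 * s],
    [/\ A = x + y, C = x - y & B = 2 * s] | [/\ B = x + y, C = x - y & A = 2 * s]].
Proof.
have [a [a2 ha]] := sqr_mod4 A; have [b [b2 hb]] := sqr_mod4 B.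
have [c [c2 hc]] := sqr_mod4 C => E.
case: ha hb hc => [] [aE a2E] [] [bE b2E] [] [cE c2E]; rewrite a2E b2E c2E in E; try lia.
- by exists (a + b), (a - b), c; constructor 1; split; lia.
- by exists (b + c + 1), (b - c), a; constructor 3; split; lia.
- by exists (a + c + 1), (a - c), b; constructor 2; split; lia.
- by exists (a + b + 1), (a - b), c; constructor 1; split; lia.
Qed.

(** Exactly one of [x], [y] is divisible by 3; the other serves as [z]. *)
Lemma octagonal_good_of_units (K x y s : int) :
  K = x ^+ 2 + y ^+ 2 + 2 * s ^+ 2 -> ~~ (3 %| x + y)%Z -> ~~ (3 %| x - y)%Z ->
  ~~ (3 %| 2 * s)%Z -> octagonal_good K.
Proof.
move=> KE xy x_y s2.
have s3 : ~~ (3 %| s)%Z by apply: contra s2 => /dvdz_mull.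
case: (boolP (3 %| x)%Z) => x3; last by exists y, x, s; rewrite (negbTE s3) andbF; split => //; rewrite KE; ring.
exists x, y, s; rewrite (negbTE s3) andbF; split => //.
by apply: contra xy => y3; rewrite rpredD.
Qed.

(** [2 K] is 0 modulo 3, so in a representation not divisible by 3 throughout all three squares are
    1 modulo 3. *)
Lemma octagonal_good_dvd3 (K : int) : 0 < K -> (3 %| K)%Z -> sum3sq (2 * K) -> octagonal_good K.
Proof.
move=> K_gt0 /dvdzP[k kE] h.
have [|A [B [C [E nd]]]] := sum3sq_primitive_at3 _ h; first lia.
have [A3 B3 C3] : [/\ ~~ (3 %| A)%Z, ~~ (3 %| B)%Z & ~~ (3 %| C)%Z].
  move: nd; case: (boolP (3 %| A)%Z) => [/nonunit_sqr_mod9|/unit_sqr_mod3] [a aE];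
  case: (boolP (3 %| B)%Z) => [/nonunit_sqr_mod9|/unit_sqr_mod3] [b bE];
  case: (boolP (3 %| C)%Z) => [/nonunit_sqr_mod9|/unit_sqr_mod3] [c cE] //= _;
  by exfalso; rewrite aE bE cE kE in E; clear -E; lia.
have [x [y [s H]]] := sum3sq_double_split E.
have KE (u v w : int) : 2 * K = (u + v) ^+ 2 + (u - v) ^+ 2 + (2 * w) ^+ 2 ->
    K = u ^+ 2 + v ^+ 2 + 2 * w ^+ 2.
  move=> e; apply: (@mulfI _ 2) => //; rewrite e; ring.
by case: H => [] [aE bE cE]; apply: (@octagonal_good_of_units K x y s);
  rewrite -?aE -?bE -?cE //; apply: KE; rewrite -aE -bE -cE E; ring.
Qed.

(** As 3 does not divide [e], some root [a] is prime to 3 and some root [b] is not; then [2 e = (a +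
    b) ^ 2 + (a - b) ^ 2 + 2 c ^ 2] with [a + b] and [a - b] prime to 3. *)
Lemma octagonal_good_double (e : int) : ~~ (3 %| e)%Z -> sum3sq e -> octagonal_good (2 * e).
Proof.
move=> e3 [A [B [C E]]].
have pick (a b c : int) : e = a ^+ 2 + b ^+ 2 + c ^+ 2 -> ~~ (3 %| a)%Z -> (3 %| b)%Z ->
    octagonal_good (2 * e).
  move=> eE a3 b3; exists (a + b), (a - b), c; split.
  - by rewrite eE; ring.
  - by apply: contra a3 => h; rewrite -[a](subrK b) rpredD.
  - rewrite negb_and; apply/orP; left.
    by apply: contra a3 => h; rewrite -[a](addrK b) rpredB.
case: (boolP (3 %| A)%Z) => A3; case: (boolP (3 %| B)%Z) => B3; case: (boolP (3 %| C)%Z) => C3.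
- have [a aE] := nonunit_sqr_mod9 A3; have [b bE] := nonunit_sqr_mod9 B3.
  have [c cE] := nonunit_sqr_mod9 C3.
  by case/negP: e3; apply/dvdzP; exists (3 * (a + b + c)); rewrite E aE bE cE; ring.
- by apply: (pick C A B) => //; rewrite E; ring.
- by apply: (pick B A C) => //; rewrite E; ring.
- by apply: (pick B A C) => //; rewrite E; ring.
- by apply: (pick A B C).
- by apply: (pick A B C).
- by apply: (pick A C B) => //; rewrite E; ring.
- have [a aE] := unit_sqr_mod3 A3; have [b bE] := unit_sqr_mod3 B3.
  have [c cE] := unit_sqr_mod3 C3.
  by case/negP: e3; apply/dvdzP; exists (a + b + c + 1); rewrite E aE bE cE; ring.
Qed.

Lemma octagonal_good_odd (K : nat) : odd K -> (3 %| K)%N -> octagonal_good K%:Z.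
Proof.
move=> oddK K3; apply: octagonal_good_dvd3; first by case: K oddK K3.
  exact: K3.
by rewrite -PoszM; apply: sum3sq_2mod4; lia.
Qed.

(** The classes modulo 8 other than 0, 4 and 7. *)
Definition three_square_class (e : nat) : bool :=
  [|| (e %% 4 == 1)%N, (e %% 4 == 2)%N | (e %% 8 == 3)%N].

Lemma sum3sq_class (e : nat) : three_square_class e -> sum3sq e%:Z.
Proof.
case/or3P => /eqP; [exact: sum3sq_1mod4 | exact: sum3sq_2mod4 | exact: sum3sq_3mod8].
Qed.

Lemma sum3sq_mul4 (e : int) : sum3sq e -> sum3sq (4 * e).
Proof. by case=> x [y [z ->]]; exists (2 * x), (2 * y), (2 * z); ring. Qed.

Lemma octagonal_good_even (e : nat) : ~~ (3 %| e)%N ->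
  three_square_class e || ((4 %| e)%N && three_square_class (e %/ 4)) -> octagonal_good (2 * e%:Z).
Proof.
move=> e3 cls; apply: octagonal_good_double; first exact: e3.
case/orP: cls => [/sum3sq_class //|/andP[/dvdnP[k ->]]].
by rewrite mulnK // mulnC PoszM => /sum3sq_class/sum3sq_mul4.
Qed.

(** Here [K = n + 2 - 7 j] with [T ^ 2 = 3 j + 1], and [T] is chosen by [n] modulo 6 so that [K] is
    an odd multiple of 3. The bound 147 is [7 * 21], for [T = 8]. *)
Lemma octagonal_7 (n : nat) : (147 <= n)%N ->
  exists x y z t : int, P8 x + 2 * P8 y + 3 * P8 z + 7 * P8 t = n%:Z.
Proof.
move=> n_ge.
have use (T j K : nat) : (T ^ 2 = 3 * j + 1)%N -> (n + 2 = 7 * j + K)%N -> odd K -> (3 %| K)%N ->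
    exists x y z t : int, P8 x + 2 * P8 y + 3 * P8 z + 7 * P8 t = n%:Z.
  move=> TE nE oK K3; apply: (octagonal_good_rep (octagonal_good_odd oK K3) (T := T)).
    by apply: contraTN K3 => /= T3; have : (3 %| T ^ 2)%N by [rewrite dvdn_exp]; rewrite TE; lia.
  have -> : T%:Z ^+ 2 = 3 * j%:Z + 1 by rewrite -[1]/(Posz 1) -PoszM -PoszD -TE -mulnn PoszM expr2.
  lia.
have : (n %% 6 < 6)%N by rewrite ltn_pmod.
case E: (n %% 6)%N => [|[|[|[|[|[|//]]]]]] _.
- by apply: (use 4%N 5%N (n + 2 - 35)%N); lia.
- by apply: (use 1%N 0%N (n + 2)%N); lia.
- by apply: (use 2%N 1%N (n + 2 - 7)%N); lia.
- by apply: (use 5%N 8%N (n + 2 - 56)%N); lia.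
- by apply: (use 8%N 21%N (n + 2 - 147)%N); lia.
- by apply: (use 7%N 16%N (n + 2 - 112)%N); lia.
Qed.

(** Here [K = n + 5 - 3 T ^ 2]. If 3 divides [n + 5], the parity of [T] makes [K] odd; otherwise it
    makes [K = 2 e], and [T] is varied until [e] or [e / 4] lies in a three-square class. *)
Lemma octagonal_9 (n : nat) : (147 <= n)%N ->
  exists x y z t : int, P8 x + 2 * P8 y + 3 * P8 z + 9 * P8 t = n%:Z.
Proof.
move=> n_ge.
have use (T : nat) (K : int) : n%:Z + 5 = 3 * (T ^ 2)%N%:Z + K -> ~~ (3 %| T)%N -> octagonal_good K ->
    exists x y z t : int, P8 x + 2 * P8 y + 3 * P8 z + 9 * P8 t = n%:Z.
  move=> nE T3 gK; apply: (octagonal_good_rep gK (T := T)) => //.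
  move: nE; rewrite -mulnn PoszM -expr2; lia.
case: (boolP (3 %| n + 5)%N) => n3.
  case: (boolP (odd n)) => on.
    apply: (use 1%N (n + 2)%N) => //; first lia.
    by apply: octagonal_good_odd; lia.
  apply: (use 2%N (n - 7)%N) => //; first lia.
  by apply: octagonal_good_odd; lia.
have use2 (T e : nat) : (n + 5 = 3 * T ^ 2 + 2 * e)%N -> ~~ (3 %| T)%N ->
    three_square_class e || ((4 %| e)%N && three_square_class (e %/ 4)) ->
    exists x y z t : int, P8 x + 2 * P8 y + 3 * P8 z + 9 * P8 t = n%:Z.
  move=> nE T3 cls; apply: (use T (2 * e%:Z)) => //; first lia.
  by apply: octagonal_good_even => //; move: (T ^ 2)%N nE n3; clear; lia.
rewrite /three_square_class in use2.
case: (boolP (odd n)) => on.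
  case: (boolP ((n + 5) %/ 2 %% 4 \in [:: 0; 3]))%N => h.
    by apply: (use2 2%N ((n + 5) %/ 2 - 6)%N) => //; move: h; rewrite !inE; lia.
  by apply: (use2 4%N ((n + 5) %/ 2 - 24)%N) => //; move: h; rewrite !inE; lia.
pose e := ((n + 2) %/ 2)%N.
have [nE e_ge] : (n + 2 = 2 * e)%N /\ (73 <= e)%N by rewrite /e; lia.
have T1 : (n + 5 = 3 * 1 ^ 2 + 2 * e)%N by clear -nE e_ge; lia.
have T5 : (n + 5 = 3 * 5 ^ 2 + 2 * (e - 36))%N by clear -nE e_ge; lia.
have T7 : (n + 5 = 3 * 7 ^ 2 + 2 * (e - 72))%N by clear -nE e_ge; lia.
have : (e %% 16 < 16)%N by rewrite ltn_pmod.
(* Passing from [T = 1] to 5 or 7 lowers [e] by 36 or 72, that is, by 4 or 8 modulo 16: this moves 7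
   to 3 modulo 8, and 12 and 0 to 8 modulo 16. *)
have [h|h|h] : [\/ (e %% 4 \in [:: 1; 2])%N \/ (e %% 8 = 3)%N \/ (e %% 16 \in [:: 4; 8])%N,
   (e %% 8 = 7)%N \/ (e %% 16 = 12)%N | (e %% 16 = 0)%N].
- have : (e %% 16 < 16)%N by rewrite ltn_pmod.
  rewrite !inE => h.
  case: (boolP (e %% 16 == 0)%N) => [/eqP|h0]; first by constructor 3.
  case: (boolP ((e %% 8 == 7) || (e %% 16 == 12))%N) => h1.
    by constructor 2; clear -h1; lia.
  by constructor 1; clear -h h0 h1; lia.
- by move=> _; apply: (use2 1%N e T1) => //; move: h; rewrite !inE; clear; lia.
- by move=> _; apply: (use2 5%N (e - 36)%N T5) => //; move: h; clear -e_ge; lia.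
- by move=> _; apply: (use2 7%N (e - 72)%N T7) => //; move: h; clear -e_ge; lia.
Qed.

(** All values of [P8] below 147. *)
Definition octagonals : seq nat := [:: 0; 1; 5; 8; 16; 21; 33; 40; 56; 65; 85; 96; 120; 133]%N.

Lemma octagonalsP (k : nat) : k \in octagonals -> exists x, P8 x = k%:Z.
Proof.
have : all (fun k : nat => has (fun x => P8 x == k%:Z)
   [:: 0; 1; -1; 2; -2; 3; -3; 4; -4; 5; -5; 6; -6; 7]) octagonals by vm_compute.
by move=> /allP h /h /hasP[x _ /eqP <-]; exists x.
Qed.

Definition octagonal_check (c n : nat) : bool :=
  has (fun t => has (fun z => has (fun y => has (fun x =>
    x + 2 * y + 3 * z + c * t == n) octagonals) octagonals) octagonals) [:: 0; 1; 5; 8; 16]%N.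

Lemma octagonal_checkP (c n : nat) : octagonal_check c n ->
  exists x y z t : int, P8 x + 2 * P8 y + 3 * P8 z + c%:Z * P8 t = n%:Z.
Proof.
case/hasP => kt kt_in /hasP[kz /octagonalsP[z zE] /hasP[ky /octagonalsP[y yE]]].
case/hasP => kx /octagonalsP[x xE] /eqP <-.
have /octagonalsP[t tE] : kt \in octagonals.
  by move: kt_in; rewrite !inE; do 4![case/orP => [/eqP->//|]] => /eqP->.
by exists x, y, z, t; rewrite xE yE zE tE.
Qed.

Lemma octagonal_small (c n : nat) : c \in [:: 7; 9]%N -> (n < 147)%N -> octagonal_check c n.
Proof.
move=> c79 n_lt.
have /allP : all (octagonal_check c) (iota 0 147).
  by move: c79; rewrite !inE => /orP[]/eqP ->; lazy.
by apply; rewrite mem_iota.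
Qed.

Theorem theorem2p4 :
  (forall n : nat,
     (exists x y z t : int, P8 x + 2 * P8 y + 3 * P8 z + 7 * P8 t = n%:Z) /\
     (exists x y z t : int, P8 x + 2 * P8 y + 3 * P8 z + 9 * P8 t = n%:Z)) /\
  universal [tuple 1%N; 2%N; 3%N; 7%N] /\
  universal [tuple 1%N; 2%N; 3%N; 9%N].
Proof.
have rep n :
     (exists x y z t : int, P8 x + 2 * P8 y + 3 * P8 z + 7 * P8 t = n%:Z) /\
     (exists x y z t : int, P8 x + 2 * P8 y + 3 * P8 z + 9 * P8 t = n%:Z).
  case: (ltnP n 147) => hn; last by split; [apply: octagonal_7 | apply: octagonal_9].
  by split; apply: octagonal_checkP; apply: octagonal_small.
split; first exact: rep.
split=> n; have [[x [y [z [t E7]]]] [x' [y' [z' [t' E9]]]]] := rep n.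
  exists [tuple x; y; z; t]; rewrite /Phi -E7 !big_ord_recl big_ord0 !(tnth_nth 0%N) !(tnth_nth 0) /=.
  by rewrite mul1r addr0 !addrA.
exists [tuple x'; y'; z'; t']; rewrite /Phi -E9 !big_ord_recl big_ord0 !(tnth_nth 0%N) !(tnth_nth 0) /=.
by rewrite mul1r addr0 !addrA.
Qed.
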